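(* For every infinite cardinal $\kappa$, $$\mathfrak{Dau}(L_\infty(\{0,1\}^\kappa))=\max(\operatorname{cof}\mathcal{N},\operatorname{cof}[\kappa]^\omega).$$ In particular, $\mathfrak{Dau}(L_\infty[0,1])=\operatorname{cof}\mathcal{N}$.
   Context: All Banach spaces are real. $\{0,1\}^\kappa$ carries the product probability measure of the uniform measures on $\{0,1\}$, and $[0,1]$ carries Lebesgue measure. $\mathcal{N}$ is the family of subsets of $\mathbb{R}$ of Lebesgue measure zero, $[\kappa]^\omega$ is the family of all countable subsets of $\kappa$, and for a family $\mathcal{F}$ of sets, $\operatorname{cof}\mathcal{F}$ is the least cardinality of a subfamily $\mathcal{G}\subseteq\mathcal{F}$ such that every set in $\mathcal{F}$ is contained in some set in $\mathcal{G}$. $B_X$ and $S_X$ denote the closed unit ball and unit sphere of a Banach space $X$. A slice of $B_X$ is a nonempty intersection of $B_X$ with an open half-space, i.e. a set $\{x\in B_X: f(x)>\sup f(B_X)-\alpha\}$ with $f\in X^*$, $\alpha>0$. For a cardinal $\kappa$, $\{y_\alpha:\alpha<\kappa\}$ denotes a set of cardinality at most $\kappa$. $X$ has the $\kappa$-Daugavet property if for every family $\{y_\alpha:\alpha<\kappa\}\subseteq S_X$, every slice $S$ of $B_X$ and every $\varepsilon>0$ there is $x\in S$ with $\|y_\alpha+x\|>2-\varepsilon$ for all $\alpha<\kappa$. For nonzero $X$, $\mathfrak{Dau}(X)$ is the least cardinal $\kappa$ such that $X$ fails the $\kappa$-Daugavet property. *)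

(* Defs.v *)
From HB Require Import structures.
From mathcomp Require Import all_boot all_order all_algebra.
From mathcomp Require Import finmap.
From mathcomp Require Import all_classical all_reals all_analysis.
From mathcomp Require Import ess_sup_inf hoelder.

Set Implicit Arguments.
Unset Strict Implicit.
Unset Printing Implicit Defensive.

Import Order.TTheory GRing.Theory Num.Theory.
Import numFieldNormedType.Exports.

Local Open Scope classical_set_scope.
Local Open Scope card_scope.
Local Open Scope ring_scope.

(* A cardinal is represented by any type of that cardinality: two types stand
   for the same cardinal when they are equinumerous (#=), and cardinals are
   compared by #<=. Naming the universe makes all cardinals of a statement, the
   index set of {0,1}^kappa included, live at the same level. *)
Definition cardinal := Type.

Definition card_max (K L : cardinal) : cardinal :=
  if [set: K] #<= [set: L] then L else K.

Lemma ex_least_card (J : Type) (T_ : J -> Type) (j0 : J) :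
  exists j, forall k, [set: T_ j] #<= [set: T_ k].
Proof.
pose Pi := forall j : J, T_ j.
pose ok (F : set Pi) := forall f g, F f -> F g ->
  (exists j, f j = g j) -> f = g.
have [|F [Fok Fmax]] := @Zorn_bigcup Pi ok.
  move=> C C_ok C_tot f g [X CX Xf] [Y CY Yg] fg.
  have [XY|YX] := C_tot _ _ CX CY.
    by apply: (C_ok Y) => //; exact: XY.
  by apply: (C_ok X) => //; exact: YX.
have [[j onto]|/forallNP h] :=
    pselect (exists j : J, forall y : T_ j, exists2 f, F f & f j = y).
  exists j => k.
  pose pr y := sval (cid2 (onto y)).
  have [prF prK] : (forall y, F (pr y)) /\ (forall y, pr y j = y).
    by split=> y; rewrite /pr; case: cid2.
  have /Pinj[p _] : {in [set: T_ j] &, injective (fun y => pr y k)}.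
    move=> x y _ _ e; rewrite -[x]prK -[y]prK.
    by congr (_ j); apply: Fok => //; exists k.
  exact: (inj_card_le ('totalfun_setT p)).
have {}h j : exists y : T_ j, forall f, F f -> f j <> y.
  have /existsNP[y hy] := h j; exists y => f Ff fjy; apply: hy; by exists f.
pose g : Pi := fun j => sval (cid (h j)).
have gP j f : F f -> f j <> g j by rewrite /g; case: cid => /= y; exact.
exfalso; apply: (Fmax (F `|` [set g])).
  split=> [f Ff|/(_ g (or_intror erefl)) Fg]; first by left.
  exact: (gP j0 g Fg).
move=> f1 f2 [F1|->] [F2|->] // [j].
- by move=> e; apply: Fok => //; exists j.
- by move/gP => /(_ F1).
- by move/esym/gP => /(_ F2).
Qed.

Section cofinality.
Variables (T : Type) (F : set (set T)).

Definition cofinal_subfamily (G : set (set T)) : Prop :=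
  G `<=` F /\ forall A, F A -> exists2 B, G B & A `<=` B.

Lemma ex_least_cofinal : exists G, cofinal_subfamily G /\
  forall H, cofinal_subfamily H -> G #<= H.
Proof.
have FF : cofinal_subfamily F by split=> // A FA; exists A.
have [[G Gc] Gmin] :=
  ex_least_card (fun j : {G | cofinal_subfamily G} => set_type (sval j))
                (exist _ F FF).
exists G; split=> // H Hc; have := Gmin (exist _ H Hc) => /=.
by rewrite (card_le_eql (card_setT _)) (card_le_eqr (card_setT _)).
Qed.

(* The cardinal is represented by a cofinal subfamily of least cardinality. *)
Definition cof : cardinal := set_type (sval (cid ex_least_cofinal)).

End cofinality.

Definition null_sets (R : realType) : set (set R) :=
  (@lebesgue_measure R).-negligible.

Arguments null_sets : clear implicits.

Definition countable_subsets (K : Type) : set (set K) := [set A | countable A].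

Arguments countable_subsets : clear implicits.

Section daugavet.
Context {R : realType} (X : normedModType R).

Definition unit_ball : set X := [set x | `|x| <= 1].
Definition unit_sphere : set X := [set x | `|x| = 1].

Definition is_slice (S : set X) : Prop :=
  exists (f : {linear X -> R^o}) (a : R),
    [/\ continuous f, 0 < a &
      S = [set x | unit_ball x /\ f x > sup (f @` unit_ball) - a]].

Definition kappa_daugavet (K : cardinal) : Prop :=
  forall Y : set X, Y `<=` unit_sphere -> Y #<= [set: K] ->
  forall S : set X, is_slice S ->
  forall e : R, 0 < e ->
  exists2 x, S x & forall y, Y y -> `|y + x| > 2 - e.

(* K = Dau(X), for cardinals up to equinumerosity *)
Definition is_Dau (K : cardinal) : Prop :=
  ~ kappa_daugavet K /\
  forall L : cardinal, ~ kappa_daugavet L -> [set: K] #<= [set: L].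

End daugavet.

Section Linfty.
Context d (T : measurableType d) (R : realType).
Variable mu : {measure set T -> \bar R}.

Lemma le1_pinfty : (1 <= +oo :> \bar R)%E. Proof. exact: leey. Qed.

(* essentially bounded measurable functions T -> R, before identification *)
Local Notation Lf := (LfunType mu le1_pinfty).

Definition Linfty_eq (f g : Lf) : bool := `[< f = g %[ae mu] >].

Lemma Linfty_eq_refl : reflexive Linfty_eq.
Proof. by move=> f; apply/asboolP; exact: ae_eq_refl. Qed.

Lemma Linfty_eq_sym : symmetric Linfty_eq.
Proof. by move=> f g; apply/idP/idP => /asboolP h; apply/asboolP/ae_eq_sym. Qed.

Lemma Linfty_eq_trans : transitive Linfty_eq.
Proof.
by move=> f g h /asboolP gf /asboolP fh; apply/asboolP/(ae_eq_trans gf fh).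
Qed.

Canonical Linfty_equiv :=
  EquivRel Linfty_eq Linfty_eq_refl Linfty_eq_sym Linfty_eq_trans.

Local Open Scope quotient_scope.

Definition Linfty : Type := {eq_quot Linfty_eq}.
HB.instance Definition _ := Choice.on Linfty.
HB.instance Definition _ := EqQuotient.on Linfty.

Local Notation pi := (\pi_Linfty).

Lemma LinftyP (f g : Lf) : (pi f = pi g) <-> f = g %[ae mu].
Proof. by split=> [/eqmodP/asboolP//|h]; apply/eqmodP/asboolP. Qed.

Lemma LinftyW (P : Linfty -> Prop) : (forall f, P (pi f)) -> forall u, P u.
Proof. by move=> h u; rewrite -[u]reprK. Qed.

Definition Linfty_add (u v : Linfty) : Linfty := pi (repr u + repr v).
Definition Linfty_opp (u : Linfty) : Linfty := pi (- repr u).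
Definition Linfty_scale (a : R) (u : Linfty) : Linfty := pi (a *: repr u).
Definition Linfty_norm (u : Linfty) : R := fine ('N[mu]_+oo[EFin \o repr u])%E.

Lemma repr_ae (f : Lf) : repr (pi f) = f %[ae mu].
Proof. by apply/LinftyP; rewrite reprK. Qed.

Lemma pi_add (f g : Lf) : Linfty_add (pi f) (pi g) = pi (f + g).
Proof.
apply/LinftyP; have := repr_ae f; have := repr_ae g.
by apply: filterS2 => x /(_ I) hg /(_ I) hf _ /=; rewrite !fctE hg hf.
Qed.

Lemma pi_opp (f : Lf) : Linfty_opp (pi f) = pi (- f).
Proof.
apply/LinftyP; have := repr_ae f.
by apply: filterS => x /(_ I) hf _ /=; rewrite !fctE hf.
Qed.

Lemma pi_scale a (f : Lf) : Linfty_scale a (pi f) = pi (a *: f).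
Proof.
apply/LinftyP; have := repr_ae f.
by apply: filterS => x /(_ I) hf _ /=; rewrite !fctE hf.
Qed.

Lemma pi_norm (f : Lf) : Linfty_norm (pi f) = fine ('N[mu]_+oo[EFin \o f])%E.
Proof.
rewrite /Linfty_norm unlock /Lnorm; case: ifP => // _; congr fine.
apply: eq_ess_sup; have := repr_ae f.
by apply: filterS => x /(_ I) hf /=; rewrite hf.
Qed.

Lemma Linfty_addA : associative Linfty_add.
Proof.
move=> u v w; elim/LinftyW: u => f; elim/LinftyW: v => g; elim/LinftyW: w => h.
by rewrite !pi_add addrA.
Qed.

Lemma Linfty_addC : commutative Linfty_add.
Proof. by move=> u v; elim/LinftyW: u => f; elim/LinftyW: v => g; rewrite !pi_add addrC. Qed.

Lemma Linfty_add0 : left_id (pi 0) Linfty_add.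
Proof. by move=> u; elim/LinftyW: u => f; rewrite pi_add add0r. Qed.

Lemma Linfty_addN : left_inverse (pi 0) Linfty_opp Linfty_add.
Proof. by move=> u; elim/LinftyW: u => f; rewrite pi_opp pi_add addNr. Qed.

HB.instance Definition _ := GRing.isZmodule.Build Linfty
  Linfty_addA Linfty_addC Linfty_add0 Linfty_addN.

Lemma Linfty_scaleA a b u :
  Linfty_scale a (Linfty_scale b u) = Linfty_scale (a * b) u.
Proof. by elim/LinftyW: u => f; rewrite !pi_scale scalerA. Qed.

Lemma Linfty_scale1 : left_id 1 Linfty_scale.
Proof. by move=> u; elim/LinftyW: u => f; rewrite pi_scale scale1r. Qed.

Lemma Linfty_scaleDr : right_distributive Linfty_scale +%R.
Proof.
move=> a u v; elim/LinftyW: u => f; elim/LinftyW: v => g.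
by rewrite /GRing.add/= pi_add !pi_scale pi_add scalerDr.
Qed.

Lemma Linfty_scaleDl u : {morph Linfty_scale^~ u : a b / a + b}.
Proof.
move=> a b; elim/LinftyW: u => f.
by rewrite [in RHS]/GRing.add/= !pi_scale pi_add scalerDl.
Qed.

HB.instance Definition _ := GRing.Zmodule_isLmodule.Build R Linfty
  Linfty_scaleA Linfty_scale1 Linfty_scaleDr Linfty_scaleDl.

Lemma Linfty_normD u v : Linfty_norm (u + v) <= Linfty_norm u + Linfty_norm v.
Proof.
elim/LinftyW: u => f; elim/LinftyW: v => g.
rewrite [X in Linfty_norm X]pi_add !pi_norm; exact: ler_LnormD.
Qed.

Lemma Linfty_normZ a u : Linfty_norm (a *: u) = `|a| * Linfty_norm u.
Proof.
elim/LinftyW: u => f; rewrite [X in Linfty_norm X]pi_scale !pi_norm.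
apply/EFin_inj; rewrite finite_norm_fine EFinM finite_norm_fine.
exact: LnormZ.
Qed.

Lemma Linfty_norm0_eq0 u : Linfty_norm u = 0 -> u = 0.
Proof.
elim/LinftyW: u => f; rewrite pi_norm => /fine_Lnormr_eq0 f0.
exact/LinftyP.
Qed.

HB.instance Definition _ := Lmodule_isNormed.Build R Linfty
  Linfty_normD Linfty_normZ Linfty_norm0_eq0.

End Linfty.

Section cantor_measure.
Variables (R : realType) (K : Type).
Local Open Scope ereal_scope.

(* [Some (J, b)] codes the cylinder of the x that agree with b on the finite set
   J, of product measure 2^-#|J|; [None] codes the empty set. *)
Definition cyl_code : Type := option ({fset {classic K}} * (K -> bool)).

Definition cyl (c : cyl_code) : set (K -> bool) :=
  if c is Some (J, b) then [set x | forall i, i \in J -> x i = b i] else set0.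

Definition cyl_mass (c : cyl_code) : \bar R :=
  if c is Some (J, _) then ((2^-1 : R) ^+ #|` J|)%:E else 0.

Lemma cyl_mass_ge0 c : 0 <= cyl_mass c.
Proof. by case: c => [[J b]|] //=; rewrite lee_fin exprn_ge0. Qed.

(* Outer measure whose Caratheodory restriction is the (completed) product of
   the uniform measures on the factors {0,1}. *)
Definition cantor_outer (A : set (K -> bool)) : \bar R :=
  ereal_inf [set \sum_(n <oo) cyl_mass (C n) |
              C in [set C : nat -> cyl_code | A `<=` \bigcup_n cyl (C n)]].

Lemma cantor_outer0 : cantor_outer set0 = 0.
Proof.
apply/eqP; rewrite eq_le; apply/andP; split; last first.
  by apply: le_ereal_inf_tmp => x [C _ <-]; apply: nneseries_ge0 => *;
    exact: cyl_mass_ge0.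
apply: ereal_inf_lbound; exists (fun=> None) => //.
by rewrite eseries0.
Qed.

Lemma cantor_outer_ge0 A : 0 <= cantor_outer A.
Proof.
apply: le_ereal_inf_tmp => x [C _ <-]; apply: nneseries_ge0 => *.
exact: cyl_mass_ge0.
Qed.

Lemma le_cantor_outer : {homo cantor_outer : A B / A `<=` B >-> A <= B}.
Proof.
move=> A B AB; apply/ereal_inf_le_tmp => x [C BC <-].
by exists C => //; exact: subset_trans AB BC.
Qed.

Lemma cantor_outer_sigma_subadditive : sigma_subadditive cantor_outer.
Proof.
move=> A; have [[i ioo]|] := pselect (exists i, cantor_outer (A i) = +oo).
  rewrite (eseries_pinfty _ _ ioo) ?leey// => n _.
  by rewrite -ltNye (lt_le_trans _ (cantor_outer_ge0 _)).
rewrite -forallNE => Aoo.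
apply/lee_addgt0Pr => e e0.
rewrite (le_trans _ (epsilon_trick _ _ (ltW e0)))//; last first.
  by move=> n; exact: cantor_outer_ge0.
pose P n (B : nat -> cyl_code) := A n `<=` \bigcup_k cyl (B k) /\
  \sum_(k <oo) cyl_mass (B k) <= cantor_outer (A n) + (e / (2 ^ n.+1)%:R)%:E.
have [G PG] : {G : nat -> nat -> cyl_code & forall n, P n (G n)}.
  apply: (@choice _ _ P) => n; rewrite /P.
  have fin : cantor_outer (A n) \is a fin_num.
    by rewrite ge0_fin_numE ?cantor_outer_ge0// ltey; apply/eqP/Aoo.
  have en1 : (0 < e / (2 ^ n.+1)%:R)%R by rewrite divr_gt0.
  have [x [B AB <-] xS] := lb_ereal_inf_adherent en1 fin.
  by exists B; split => //; exact/ltW.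
pose m := cyl_mass \o uncurry G.
have m_ge0 x : 0 <= m x by exact: cyl_mass_ge0.
apply: (@le_trans _ _ (\esum_(i in setT) m i)).
  apply: ereal_inf_lbound => /=.
  have /card_esym/ppcard_eqP[f] := card_nat2.
  exists (uncurry G \o f).
    move=> t [i _ /(PG i).1 [j _ Bijt]].
    by exists (f^-1%FUN (i, j)) => //=; rewrite invK ?inE.
  rewrite -(esum_pred_image m _ xpredT) ?[fun=> _]set_true//.
  by rewrite image_eq.
rewrite (_ : esum _ _ = \sum_(i <oo) \sum_(j <oo ) cyl_mass (G i j)); last first.
  pose J : nat -> set (nat * nat) := fun i => [set (i, j) | j in setT].
  rewrite (_ : setT = \bigcup_k J k); last first.
    by rewrite predeqE => -[a b]; split => // _; exists a => //; exists b.
  rewrite esum_bigcupT /=; last 2 first.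
  - apply/trivIsetP => i j _ _ ij.
    rewrite predeqE => -[n k] /=; split => //= -[] [_] _ [<-{n} _].
    by move=> [k' _] [] /esym/eqP; rewrite (negbTE ij).
  - by move=> x; exact: m_ge0.
  rewrite -(image_id [set: nat]) -fun_true esum_pred_image//; last first.
    by move=> n _; apply: esum_ge0 => *; exact: m_ge0.
  apply: eq_eseriesr => /= j _.
  rewrite -(esum_pred_image m (pair j) predT)//=; last first.
    by move=> ? ? _ _; exact: (@can_inj _ _ _ snd).
  by congr esum; rewrite predeqE => -[a b]; split; move=> [i _ <-]; exists i.
apply: lee_nneseries => n *.
  by apply: nneseries_ge0 => k *; exact: cyl_mass_ge0.
exact: (PG n).2.
Qed.

HB.instance Definition _ := isOuterMeasure.Build R (K -> bool) cantor_outer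
  cantor_outer0 cantor_outer_ge0 le_cantor_outer cantor_outer_sigma_subadditive.

Definition cantor_space : measurableType _ := caratheodory_type cantor_outer.

Definition cantor_measure (A : set cantor_space) : \bar R := cantor_outer A.

HB.instance Definition _ := isMeasure.Build _ cantor_space R cantor_measure
  (@caratheodory_measure0 R _ cantor_outer)
  (@caratheodory_measure_ge0 R _ cantor_outer)
  (@caratheodory_measure_sigma_additive R _ cantor_outer).

End cantor_measure.

Arguments cantor_measure : clear implicits.

Section unit_interval.
Variable R : realType.

Definition unit_itv : Type := {x : R | 0 <= x <= 1}.
HB.instance Definition _ := Choice.on unit_itv.

Definition unit_itv_val : unit_itv -> R := val.

Lemma unit_itv0 : 0 <= (0 : R) <= 1. Proof. by rewrite lexx ler01. Qed.
HB.instance Definition _ := isPointed.Build unit_itv (exist _ 0 unit_itv0).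

(* [0,1] with the trace of the Borel sets of R *)
Definition unit_itv_space : measurableType _ :=
  g_sigma_algebra_preimageType (unit_itv_val : unit_itv -> measurableTypeR R).

Local Open Scope ereal_scope.

Definition unit_itv_measure (A : set unit_itv_space) : \bar R :=
  lebesgue_measure (unit_itv_val @` A).

Lemma measurable_unit_itv_image (A : set unit_itv_space) :
  measurable A -> measurable (unit_itv_val @` A : set (measurableTypeR R)).
Proof.
move=> [B mB <-]; rewrite setTI.
rewrite (_ : _ @` _ = B `&` `[0%R, 1%R]%classic).
  by apply: measurableI => //; exact: measurable_itv.
apply/seteqP; split=> [_ [x Bx <-]|x [Bx]] /=.
  by split=> //; rewrite in_itv/=; exact: (valP x).
by rewrite in_itv/= => x01; exists (exist _ x x01).
Qed.

Lemma unit_itv_measure0 : unit_itv_measure set0 = 0.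
Proof. by rewrite /unit_itv_measure image_set0 measure0. Qed.

Lemma unit_itv_measure_ge0 A : 0 <= unit_itv_measure A.
Proof. exact: measure_ge0. Qed.

Lemma unit_itv_measure_sigma_additive : semi_sigma_additive unit_itv_measure.
Proof.
move=> F mF tF mUF; rewrite /unit_itv_measure image_bigcup.
apply: measure_semi_sigma_additive.
- by move=> i; exact: measurable_unit_itv_image.
- apply/trivIsetP => i j _ _ ij; move/trivIsetP: tF => /(_ i j I I ij) FF.
  rewrite -subset0 => _ [[x Fx <-] [y Fy /val_inj xy]].
  suff : set0 x by [].
  by rewrite -FF; split; [exact: Fx|rewrite -xy].
- by rewrite -image_bigcup; exact: measurable_unit_itv_image.
Qed.

HB.instance Definition _ := isMeasure.Build _ unit_itv_space R unit_itv_measure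
  unit_itv_measure0 unit_itv_measure_ge0 unit_itv_measure_sigma_additive.

End unit_interval.

Arguments unit_itv_measure : clear implicits.

(* Main.v *)
Require Import Defs.
From HB Require Import structures.
From mathcomp Require Import all_boot all_order all_algebra.
From mathcomp Require Import finmap.
From mathcomp Require Import all_classical all_reals all_analysis.
From mathcomp Require Import ess_sup_inf hoelder measurable_realfun.
From mathcomp Require Import ring lra.

(** Both bounds go through disjoint blocks of coordinates of {0,1}^K: the events
    "x vanishes on the block F" are independent, of measure 2^-|F|. Only
    this fairness of the coordinates matters, so that [0,1], with its binary
    digits as coordinates, behaves like {0,1}^nat.

    Lower bound. Suppose that Y defeats a slice of the functional f, and let A_y
    be a set of positive measure where y has constant sign and is close to 1 in
    modulus. Given small events U_{n,q} on blocks, with level n of measure at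
    most 2^-n, label each point by the last level it meets, modulo a large m.
    The m regions are disjoint. Changing a near-maximal point of the slice to 1
    on one region and to -1 on the next changes f little for one of the pairs of
    regions (additivity of f), so some y in Y has A_y null on a region; hence
    A_y nearly misses U_{n,q} for infinitely many n and all q. By independence,
    A_y can nearly miss only families of events of finite total measure. If the
    blocks are indexed by rational intervals, the limsup of the intervals whose
    events A_y nearly misses is a null set, and these null sets are cofinal. If
    they are indexed by elements of K, only countably many elements are met, and
    these countable sets are cofinal.

    Upper bound. It suffices to find few sets D of positive measure such that
    every Z of small measure is null on some D: then Y consists of the -1_D, and
    the slice is given by the mean. An open O containing Z depends on countably
    many coordinates, so one may work in {0,1}^nat. The points all of whose
    finite modifications lie in O form a null set N, which is carried by binary
    expansion into a null set G of a cofinal family. A set P of positive measure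
    disjoint from the preimage of G misses N, and a Baire argument gives a
    cylinder C and a finite flip t such that P inter C is of positive measure
    and t(P inter C) is almost disjoint from O. Put D = t(P inter C). *)

Set Implicit Arguments.
Unset Strict Implicit.
Unset Printing Implicit Defensive.

Import Order.TTheory GRing.Theory Num.Theory.
Import numFieldNormedType.Exports.

Local Open Scope classical_set_scope.
Local Open Scope card_scope.
Local Open Scope ring_scope.

(** * Cardinal arithmetic *)

Lemma card_leTP (S U : Type) :
  [set: S] #<= [set: U] <-> exists f : S -> U, injective f.
Proof.
split=> [/card_leP[f]|[f finj]].
  exists (fun s => val (f (SigSub (mem_set (I : [set: S] s))))).
  move=> s t /val_inj /(inj (mem_set I) (mem_set I)) H.
  by have := congr1 val H.
have /Pinj[g _] : {in [set: S] &, injective f} by move=> x y _ _; exact: finj.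
exact: inj_card_le ('totalfun_setT g).
Qed.

(** A family of two types, indexed by the booleans, has a least member. *)
Lemma card_le_total (S U : Type) :
  [set: S] #<= [set: U] \/ [set: U] #<= [set: S].
Proof.
have [[] h] := ex_least_card (fun b : bool => if b then S else U) true.
  by left; exact: (h false).
by right; exact: (h true).
Qed.

Lemma sval_inj (T : Type) (P : T -> Prop) : injective (@sval T P).
Proof. by move=> [x hx] [y hy] /= xy; subst y; rewrite (Prop_irrelevance hx hy). Qed.

(* Zorn on the graphs of pairing functions [A * A -> A], [A] infinite: a maximal
   one has [A] of full cardinality, for otherwise it extends to [A] plus a
   disjoint copy of [A]. *)
Lemma infinite_card_square (K : Type) :
  infinite_set [set: K] -> [set: K * K] #<= [set: K].
Proof.
move=> /infiniteP /card_leTP[iota iota_inj].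
pose dom (G : set (K * K * K)) := [set a | exists b c, G (a, b, c)].
pose good G := [/\ forall a b a' b' c, G (a, b, c) -> G (a', b', c) ->
    a = a' /\ b = b',
  forall a b, dom G a -> dom G b -> exists c, G (a, b, c) &
  forall a b c, G (a, b, c) -> dom G b /\ dom G c].
pose G0 : set (K * K * K) := [set t | exists m n,
  t = (iota m, iota n, iota (choice.pickle (m, n)))].
have domG0 n : dom G0 (iota n) by exists (iota 0%N), (iota (choice.pickle (n, 0%N))), n, 0%N.
have goodG0 : good G0.
  split.
  - move=> a b a' b' c [m [n [-> -> ->]]] [m' [n' [-> -> /iota_inj]]].
    by move=> /(pcan_inj choice.pickleK)[-> ->].
  - move=> a b [b1 [c1 [m [n [-> _ _]]]]] [b2 [c2 [m' [n' [-> _ _]]]]].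
    by exists (iota (choice.pickle (m, m'))), m, m'.
  - by move=> a b c [m [n [_ -> ->]]].
have [|G [G0G Gmax]] := @Zorn_bigcup (K * K * K)%type
    [set G | (G !=set0 -> good G /\ G0 `<=` G)].
  move=> F FP Ftot [x [X FX Xx]].
  have FPg Y a : F Y -> Y a -> good Y /\ G0 `<=` Y.
    by move=> FY Ya; apply: FP => //; exists a.
  have dU Y a : F Y -> dom Y a -> dom (\bigcup_(X in F) X) a.
    by move=> FY [b [c Yabc]]; exists b, c, Y.
  split; last first.
    by have [_ G0X] := FPg _ _ FX Xx => y /G0X; exists X.
  split.
  - move=> a b a' b' c [Y FY Yabc] [Z FZ Zabc].
    have [YZ|ZY] := Ftot _ _ FY FZ.
      by have [[h _ _] _] := FPg _ _ FZ Zabc; apply: h Zabc => //; exact: YZ.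
    by have [[h _ _] _] := FPg _ _ FY Yabc; apply: (h _ _ _ _ _ Yabc); exact: ZY.
  - move=> a b [b1 [c1 [Y FY Y1]]] [b2 [c2 [Z FZ Z2]]].
    have [YZ|ZY] := Ftot _ _ FY FZ.
      have [[_ h _] _] := FPg _ _ FZ Z2.
      have [||c Zc] := h a b; [by exists b1, c1; exact: YZ|by exists b2, c2|].
      by exists c, Z.
    have [[_ h _] _] := FPg _ _ FY Y1.
    have [||c Yc] := h a b; [by exists b1, c1|by exists b2, c2; exact: ZY|].
    by exists c, Y.
  - move=> a b c [Y FY Yabc].
    have [[_ _ h] _] := FPg _ _ FY Yabc.
    by have [? ?] := h _ _ _ Yabc; split; exact: (dU Y).
have GN0 : G !=set0.
  apply/set0P; apply/eqP => G_0.
  apply: (Gmax G0); last by move=> _; split.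
  split; first by rewrite G_0; exact: sub0set.
  by rewrite G_0 => /(_ (iota 0, iota 0, iota (choice.pickle (0%N, 0%N)))); apply; exists 0%N, 0%N.
have {GN0 G0G} [[Ginj Gtot Gr] G0G] := G0G GN0.
pose A := dom G.
have [p pP] : exists p : K -> K -> K, forall a b, A a -> A b -> G (a, b, p a b).
  have /choice[p pP] : forall t : K * K, exists c, A t.1 -> A t.2 -> G (t.1, t.2, c).
    move=> [a b] /=; have [Aa|nAa] := pselect (A a); last by exists a.
    have [Ab|nAb] := pselect (A b); last by exists b.
    by have [c Gc] := Gtot _ _ Aa Ab; exists c.
  by exists (fun a b => p (a, b)) => a b; exact: (pP (a, b)).
have pA a b : A a -> A b -> A (p a b) by move=> /pP h /h /Gr[].
have pI a b a' b' : A a -> A b -> A a' -> A b' -> p a b = p a' b' ->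
    a = a' /\ b = b'.
  move=> Aa Ab Aa' Ab' e; apply: (Ginj a b a' b' (p a b)); first exact: pP.
  by rewrite e; exact: pP.
have Ai n : A (iota n).
  have [b [c h]] := domG0 n; by exists b, c; exact: G0G.
(* If the complement of [A] embeds in [A], then so does all of [K], with the tags [iota 0] and
   [iota 1], and the pairing [p] suffices. Otherwise [A] has a copy [B] outside itself, and the
   pairing can be extended. *)
have [/card_leTP[i i_inj]|/card_leTP[i i_inj]] := card_le_total {x | ~ A x} {x | A x}.
  have [f [fA f_inj]] : exists f : K -> K, (forall x, A (f x)) /\ injective f.
    exists (fun x => match pselect (A x) with
      | left _ => p x (iota 0%N) | right h => p (sval (i (exist _ x h))) (iota 1%N) end).
    split=> [x|x y].
      by case: pselect => h; apply: pA => //; exact: (svalP (i _)).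
    case: pselect => hx; case: pselect => hy.
    - by move=> /pI[].
    - by move=> /pI[] // => [|_ /iota_inj]; first exact: (svalP (i _)).
    - by move=> /pI[] // => [|_ /iota_inj]; first exact: (svalP (i _)).
    - move=> /pI[] //; [exact: (svalP (i _))|exact: (svalP (i _))|].
      by move=> /sval_inj /i_inj [].
  apply/card_leTP; exists (fun t => p (f t.1) (f t.2)).
  by move=> [a b] [a' b'] /= /pI[] // /f_inj -> /f_inj ->.
pose B := [set x | exists a (h : A a), x = sval (i (exist _ a h))].
have BA x : B x -> ~ A x.
  by move=> [a [h ->]]; exact: (svalP (i (exist _ a h))).
have [r [rA rB]] : exists r : K -> K, (forall a, A a -> r a = a) /\
    (forall a (h : A a), r (sval (i (exist _ a h))) = a).
  have /choice[r rP] : forall x, exists y, (A x -> y = x) /\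
      (forall a (h : A a), x = sval (i (exist _ a h)) -> y = a).
    move=> x; have [[a [h e]]|nB] := pselect (B x); last first.
      by exists x; split=> // a h e; exfalso; apply: nB; exists a, h.
    exists a; split=> [/BA[]|a' h' e']; first by exists a, h.
    move: e'; rewrite e => /sval_inj.
    by move=> /i_inj [].
  exists r; split=> [a /(proj1 (rP a))//|a h].
  exact: ((proj2 (rP _)) a h erefl).
pose AB := A `|` B.
have rAB x : AB x -> A (r x).
  by move=> [h|[a [h ->]]]; [rewrite rA|rewrite rB].
have rI x y : AB x -> AB y -> r x = r y -> (A x <-> A y) -> x = y.
  move=> [Ax|[a [ha ->]]] [Ay|[b [hb ->]]].
  - by rewrite !rA.
  - by move=> _ [/(_ Ax) h _]; exfalso; apply: (svalP (i (exist _ b hb))).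
  - by move=> _ [_ /(_ Ay) h]; exfalso; apply: (svalP (i (exist _ a ha))).
  - rewrite !rB => e _; subst b; by rewrite (Prop_irrelevance ha hb).
(* The tag restores what [r] forgets: which of the two coordinates lie in [A]. Three values suffice,
   since pairs in $A\times A$ are already served by [p]. *)
pose tag x y := iota (if pselect (A x) then 0%N else if pselect (A y) then 1%N else 2%N).
have tagA x y : A (tag x y) by exact: Ai.
pose u x y := p (tag x y) (p (r x) (r y)).
have uA x y : AB x -> AB y -> A (u x y).
  by move=> /rAB hx /rAB hy; exact: (pA _ _ (tagA x y) (pA _ _ hx hy)).
pose q x y := match pselect (AB x /\ AB y) with
  | left h => sval (i (exist _ (u x y) (uA x y h.1 h.2))) | right _ => x end.
have qB x y : AB x -> AB y -> B (q x y).
  move=> ABx ABy; rewrite /q; case: pselect => [h|[]//].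
  by exists (u x y), (uA x y h.1 h.2).
have qI x y x' y' : AB x -> AB y -> AB x' -> AB y' -> ~ (A x /\ A y) ->
    ~ (A x' /\ A y') -> q x y = q x' y' -> x = x' /\ y = y'.
  move=> hx hy hx' hy' nxy nxy'; rewrite /q.
  case: pselect => [h|[]//]; case: pselect => [h'|[]//].
  move=> /sval_inj /i_inj [].
  move=> /pI[] //; [by apply: pA; exact: rAB|by apply: pA; exact: rAB|].
  move=> /iota_inj e /pI[]; [exact: rAB..|].
  move=> rx ry; move: e.
  have : (A x <-> A x') -> (A y <-> A y') -> x = x' /\ y = y'.
    by move=> ? ?; split; exact: rI.
  case: pselect => Ax; case: pselect => Ax' //; case: pselect => Ay //;
    case: pselect => Ay' // h0 _; try (by exfalso; auto); apply: h0; split => //.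
pose G' := G `|` [set t | [/\ AB t.1.1, AB t.1.2, ~ (A t.1.1 /\ A t.1.2) &
  t.2 = q t.1.1 t.1.2]].
have G'A a b c : G (a, b, c) -> [/\ A a, A b & A c].
  by move=> h; have [? ?] := Gr _ _ _ h; split=> //; exists b, c.
have AdG' a : AB a -> dom G' a.
  move=> [Aa|Ba].
    by have [b [c h]] := Aa; exists b, c; left.
  exists a, (q a a); right; split; [by right|by right|by move=> [/(BA _ Ba)]|by []].
have dG'A a : dom G' a -> AB a.
  move=> [b [c [Gabc|[]//]]]; left; by have [] := G'A _ _ _ Gabc.
exfalso; apply: (Gmax G').
  split=> [x Gx|]; first by left.
  pose b := sval (i (exist _ _ (Ai 0%N))).
  have Bb : B b by exists (iota 0%N), (Ai 0%N).
  move=> /(_ (b, b, q b b)) h; apply: (BA _ Bb).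
  have /G'A[] // : G (b, b, q b b).
  by apply: h; right; split; [right|right|move=> [/(BA _ Bb)]|].
move=> _; split; last by move=> x /G0G; left.
split.
- move=> a b a' b' c [Gc|/=[ABa ABb nab ->]] [Gc'|/=[ABa' ABb' nab']].
  + exact: Ginj Gc Gc'.
  + move=> ec; have [_ _ Ac] := G'A _ _ _ Gc.
    by exfalso; apply: (BA c) => //; rewrite ec; exact: qB.
  + have [_ _ Ac] := G'A _ _ _ Gc'.
    by exfalso; apply: (BA _ _ Ac); exact: qB.
  + exact: qI.
- move=> a b /dG'A ABa /dG'A ABb.
  have [[Aa Ab]|nab] := pselect (A a /\ A b).
    by exists (p a b); left; exact: pP.
  by exists (q a b); right.
- move=> a b c [Gc|/=[ABa ABb nab ->]].
    by have [Aa Ab Ac] := G'A _ _ _ Gc; split; apply: AdG'; left.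
  by split; apply: AdG' => //; right; exact: qB.
Qed.

(** * Cylinders and binary expansions *)

(** Carries covers between index sets. Injectivity is asked on the support of the code alone, so
    that [g] may be arbitrary off a countable set of coordinates. *)
Lemma cyl_pullback (R : realType) (I K : Type) (g : I -> K) (c : cyl_code I) :
  (forall J b, c = Some (J, b) ->
    {in J &, injective (g : {classic I} -> {classic K})}) ->
  exists c' : cyl_code K, cyl c' = [set x : K -> bool | cyl c (fun i => x (g i))] /\
    cyl_mass R c' = cyl_mass R c.
Proof.
case: c => [[J b]|_]; last by exists None.
move=> /(_ _ _ erefl) ginj.
pose b' (k : K) := `[< exists2 i : {classic I}, i \in J & g i = k /\ b i >].
have b'E (i : {classic I}) : i \in J -> b' (g i) = b i.
  move=> iJ; apply/asboolP/idP => [[j jJ [e bj]]|bi]; last by exists i.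
  by rewrite -(ginj _ _ jJ iJ e).
exists (Some (((g : {classic I} -> {classic K}) @` J)%fset, b')); split.
  apply/seteqP; split=> x /=.
    by move=> h i iJ /=; rewrite h ?b'E//; apply/imfsetP; exists i.
  by move=> h k /imfsetP[/= i iJ ->]; rewrite b'E// -h.
by rewrite /= card_in_imfset.
Qed.

Definition setbit (K : Type) (b : K -> bool) (k : K) (w : bool) (i : K) : bool :=
  if `[< i = k >] then w else b i.

Lemma cyl_setbit (K : Type) (J : {fset {classic K}}) (b : K -> bool)
    (k : {classic K}) (w : bool) : k \notin J ->
  cyl (Some ((k |` J)%fset, setbit b k w)) =
  cyl (Some (J, b)) `&` [set x | x k = w].
Proof.
move=> kJ; have setbitN (i : {classic K}) : i \in J -> setbit b k w i = b i.
  by rewrite /setbit; case: asboolP => // -> h; rewrite h in kJ.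
apply/seteqP; split=> x /=.
  move=> h; split=> [i iJ|]; last by rewrite h ?/setbit ?asboolT// !inE eqxx.
  by rewrite h ?setbitN// !inE iJ orbT.
move=> [h xk] i; rewrite !inE => /orP[/eqP->|iJ]; first by rewrite /setbit asboolT.
by rewrite setbitN// h.
Qed.

(** Lets a whole cover be split along one coordinate without increasing its mass, which is the
    Caratheodory condition for that coordinate. *)
Lemma cyl_splitb (R : realType) (K : Type) (c : cyl_code K) (k : K) (v : bool) :
  exists c' c'' : cyl_code K, [/\ cyl c' = cyl c `&` [set x | x k = v],
    cyl c'' = cyl c `&` [set x | x k <> v] &
    (cyl_mass R c' + cyl_mass R c'' = cyl_mass R c)%E].
Proof.
case: c => [[J b]|]; last first.
  by exists None, None; rewrite /= !set0I adde0.
have [kJ|kJ] := boolP ((k : {classic K}) \in J).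
  have [bk|bk] := eqVneq (b k) v.
    exists (Some (J, b)), None; rewrite /= adde0; split=> //.
      by apply/seteqP; split=> x; [split=> //; rewrite -bk; exact: H|case].
    by apply/seteqP; split=> x //= [/(_ _ kJ) ->].
  exists None, (Some (J, b)); rewrite /= add0e; split=> //.
    by apply/seteqP; split=> x //= [/(_ _ kJ) -> h]; rewrite h eqxx in bk.
  apply/seteqP; split=> x /=; last by case.
  by move=> h; split=> //; rewrite (h k) //; exact/eqP.
have cE w := cyl_setbit b w kJ.
exists (Some (((k : {classic K}) |` J)%fset, setbit b k v)),
  (Some (((k : {classic K}) |` J)%fset, setbit b k (~~ v))); split.
- exact: cE.
- rewrite cE; congr (_ `&` _); apply/seteqP; split=> x /=.
    by move=> ->; case: v.
  by case: (x k); case: v.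
- rewrite /= cardfsU1 kJ/= add1n -EFinD exprS; congr EFin.
  by move: (_ ^+ _) => u; lra.
Qed.

Lemma fset_ord_card (k : nat) : #|` fset_set (`I_k : set {classic nat})| = k.
Proof. by apply: card_fset_set; exact: card_eqxx. Qed.

Lemma in_fset_ord (k i : nat) :
  ((i : {classic nat}) \in fset_set (`I_k : set {classic nat})) = (i < k)%N.
Proof.
rewrite in_fset_set; last exact: finite_II.
by apply/idP/idP; rewrite inE.
Qed.

Definition prefix_cyl (x : nat -> bool) (k : nat) : cyl_code nat :=
  Some (fset_set (`I_k : set {classic nat}), x).

Lemma prefix_cylE x k :
  cyl (prefix_cyl x k) = [set y | forall i, (i < k)%N -> y i = x i].
Proof.
apply/seteqP; split=> y /= h i; first by rewrite -in_fset_ord; exact: h.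
by rewrite in_fset_ord; exact: h.
Qed.

Lemma prefix_cyl_mass (R : realType) x k :
  cyl_mass R (prefix_cyl x k) = ((2^-1 : R) ^+ k)%:E.
Proof. by rewrite /= fset_ord_card. Qed.

Section binary.
Variable R : realType.
Implicit Types (x y : nat -> bool) (t : R).

Fixpoint binval (n : nat) x : nat :=
  if n is m.+1 then (binval m x).*2 + x m else 0.

Lemma binval_inj n x y : binval n x = binval n y ->
  forall i, (i < n)%N -> x i = y i.
Proof.
elim: n => // n IH /= e i.
have xy : x n = y n.
  by have := congr1 odd e; rewrite !oddD !odd_double !oddb.
move: e; rewrite xy => /addIn /double_inj /IH h.
by rewrite ltnS leq_eqVlt => /orP[/eqP->|/h].
Qed.

Lemma eq_binval n x y : (forall i, (i < n)%N -> x i = y i) ->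
  binval n x = binval n y.
Proof.
elim: n => //= n IH h; rewrite h// IH// => i ilt; apply: h.
exact: ltn_trans ilt _.
Qed.

Definition binsum n x : R := (binval n x)%:R * 2^-1 ^+ n.

Lemma half_exp_gt0 n : 0 < (2^-1 : R) ^+ n.
Proof. by rewrite exprn_gt0. Qed.

Lemma half_expS n : (2^-1 : R) ^+ n = 2 * 2^-1 ^+ n.+1.
Proof. by rewrite exprS mulrA divff ?mul1r. Qed.

Lemma binsumS n x : binsum n.+1 x = binsum n x + (x n)%:R * 2^-1 ^+ n.+1.
Proof.
rewrite /binsum /= natrD -muln2 natrM (half_expS n); move: (_ ^+ _) => u; ring.
Qed.

Lemma binsum_le n m x : binsum n x <= binsum (n + m) x.
Proof.
elim: m => [|m IH]; first by rewrite addn0.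
rewrite addnS binsumS (le_trans IH)// lerDl mulr_ge0//.
Qed.

Lemma binsum_ge n m x : binsum (n + m) x <= binsum n x + 2^-1 ^+ n - 2^-1 ^+ (n + m).
Proof.
elim: m => [|m IH]; first by rewrite addn0 addrK.
rewrite addnS binsumS (le_trans (lerD IH (lexx _)))//.
have := half_exp_gt0 (n + m).+1; rewrite (half_expS (n + m)).
by case: (x _) => /=; move: (_ ^+ _) (_ ^+ n) => u v; lra.
Qed.

Definition binreal x : R := sup (range (fun n => binsum n x)).

Lemma binsum_le_ub n m x : binsum m x <= binsum n x + 2^-1 ^+ n.
Proof.
have [nm|mn] := leqP n m.
  rewrite -(subnKC nm); apply: (le_trans (binsum_ge _ _ _)).
  by rewrite gerBl// ltW// half_exp_gt0.
rewrite -(subnKC (ltnW mn)); apply: (le_trans (binsum_le m (n - m) x)).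
by rewrite lerDl ltW// half_exp_gt0.
Qed.

Lemma binreal_bounds n x : binsum n x <= binreal x <= binsum n x + 2^-1 ^+ n.
Proof.
apply/andP; split.
  apply: ub_le_sup; last by exists n.
  by exists (binsum n x + 2^-1 ^+ n) => _ [m _ <-]; exact: binsum_le_ub.
apply: ge_sup; first by exists (binsum n x), n.
by move=> _ [m _ <-]; exact: binsum_le_ub.
Qed.

(* The digits of 1 are all 1, so that [binreal] inverts [bindigit] on all of
   [0, 1]. *)
Definition bindigit t (n : nat) : bool :=
  if 1 <= t then true else odd (Num.truncn (t * 2 ^+ n.+1)).

Lemma truncn_double t : 0 <= t -> ((Num.truncn (t * 2))./2 = Num.truncn t)%N.
Proof.
move=> t0; have /truncn_itv/andP[h1 h2] : 0 <= t * 2 by rewrite mulr_ge0.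
apply/esym/truncn_def; move: h1 h2; set m := Num.truncn _.
rewrite -[X in X%:R <= _]odd_double_half -[X in _ < X.+1%:R]odd_double_half.
rewrite -!muln2 -!natr1 !natrD !natrM => h1 h2; apply/andP; split.
  by have : 0 <= (odd m)%:R :> R by []; lra.
have : (odd m)%:R <= 1 :> R by case: odd.
by lra.
Qed.

Lemma binval_bindigit n t : 0 <= t < 1 ->
  binval n (bindigit t) = Num.truncn (t * 2 ^+ n).
Proof.
move=> /andP[t0 t1]; elim: n => [|n IH] /=.
  by rewrite expr0 mulr1; apply/esym/truncn_def; rewrite t0.
rewrite IH /bindigit leNgt t1/= -[RHS]odd_double_half addnC; congr (_ + _.*2).
by rewrite exprSr mulrA truncn_double// mulr_ge0// exprn_ge0.
Qed.

Lemma binval_true n : binval n xpredT = (2 ^ n).-1.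
Proof.
elim: n => //= n ->; rewrite expnS mul2n.
by have := expn_gt0 2 n; case: (2 ^ n)%N => //= m _; rewrite addn1.
Qed.

Lemma halfXn n : (2^-1 : R) ^+ n * 2 ^+ n = 1.
Proof. by rewrite -exprMn mulVf ?expr1n. Qed.

Lemma bindigitK t : 0 <= t <= 1 -> binreal (bindigit t) = t.
Proof.
move=> /andP[t0 t1].
(* For every [n], both numbers then lie in one interval of length $2^{-n}$. *)
suff h n : binsum n (bindigit t) <= t <= binsum n (bindigit t) + 2^-1 ^+ n.
  apply/eqP; rewrite -subr_eq0 -normr_le0; apply/ler_addgt0Pr => e e0.
  have [n ne] : exists n : nat, (2^-1 : R) ^+ n < e.
    have [n _ /(_ n (leqnn _))] := near_infty_natSinv_expn_lt (PosNum e0).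
    by rewrite /= div1r -exprVn; exists n.
  have /andP[h1 h2] := h n; have /andP[h3 h4] := binreal_bounds n (bindigit t).
  by rewrite add0r ler_norml; apply/andP; split; lra.
have [t1'|t1'] := ltP t 1.
  rewrite /binsum binval_bindigit ?t0//.
  have /truncn_itv/andP[] : 0 <= t * 2 ^+ n by rewrite mulr_ge0// exprn_ge0.
  have := halfXn n; have := half_exp_gt0 n; rewrite -natr1.
  set u := 2^-1 ^+ n; set v := 2 ^+ n; set w := _%:R => u0 uv h1 h2.
  have -> : t = (t * v) * u by rewrite -mulrA (mulrC v) uv mulr1.
  by rewrite -{5}[u]mul1r -mulrDl !ler_pM2r// h1 ltW// natr1.
have -> : t = 1 by lra.
have -> : bindigit 1 = xpredT by apply/funext => i; rewrite /bindigit lexx.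
rewrite /binsum binval_true.
have -> : ((2 ^ n).-1%:R : R) = 2 ^+ n - 1.
  by rewrite -subn1 natrB ?expn_gt0// natrX.
rewrite mulrBl mul1r (mulrC (2 ^+ n)) halfXn; have := half_exp_gt0 n.
by move: (_ ^+ n) => u u0; apply/andP; split; lra.
Qed.

End binary.

Lemma measure_bigcup_le d (T : measurableType d) (R : realType)
    (mu : {measure set T -> \bar R}) (F : nat -> set T) :
  (forall n, measurable (F n)) ->
  (mu (\bigcup_n F n) <= \sum_(n <oo) mu (F n))%E.
Proof.
move=> mF; apply: measure_sigma_subadditive => //.
by apply: bigcup_measurable.
Qed.

Lemma half_exp_approx (R : realType) (v : R) : 0 < v < 1 ->
  exists k : nat, v < 2^-1 ^+ k <= 2 * v.
Proof.
move=> /andP[v0 v1].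
have ex : exists n : nat, (2^-1 : R) ^+ n.+1 <= v.
  have [n _ /(_ n.+1 (leqnSn n))] := near_infty_natSinv_expn_lt (PosNum v0).
  by rewrite /= div1r -exprVn => h; exists n; exact: ltW.
have [k kv kmin] := ex_minnP ex; exists k; rewrite half_expS ler_pM2l// kv andbT.
case: k kv kmin => [|k] kv kmin; first by rewrite -half_expS expr0.
rewrite -half_expS ltNge; apply/negP => /kmin; by rewrite ltnn.
Qed.

(** Trades an arbitrary cover for one by intervals from a countable list, with rational left
    endpoint and length a power of 1/2. Rounding the lengths up to such powers costs the factor
    2. *)
Lemma interval_cover (R : realType) (D : set R) (d : R) :
  (lebesgue_measure D < d%:E)%E -> d <= 1 ->
  exists (a : nat -> rat) (k : nat -> nat),
    D `<=` \bigcup_q `]ratr (a q), ratr (a q) + 2^-1 ^+ k q[%classic /\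
    (\sum_(q <oo) ((2^-1 : R) ^+ k q)%:E <= (2 * d)%:E)%E.
Proof.
move=> Dd d1.
have [s [F [mF DF] Fs] sd] := ereal_inf_lt Dd.
pose w q : \bar R := wlength idfun (F q).
have w0 q : (0 <= w q)%E by exact: wlength_ge0.
have s0 : (0 <= s)%E by rewrite -Fs; apply: nneseries_ge0 => n _ _; exact: w0.
have sfin : s \is a fin_num by rewrite ge0_fin_numE// (lt_trans sd)// ltry.
pose e := d - fine s.
have e0 : 0 < e by rewrite subr_gt0 -lte_fin fineK.
have wfin q : w q \is a fin_num.
  rewrite ge0_fin_numE//; apply: le_lt_trans (_ : (s < +oo)%E); last first.
    by rewrite (lt_trans sd)// ltry.
  rewrite -Fs; apply: le_trans (nneseries_lim_ge q.+1 _) => //.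
  by rewrite big_nat_recr//= leeDr// sume_ge0.
(* The slack [e] below [d] is spread over the intervals: lengths become positive, room appears for a
   rational left endpoint, and the total stays at most [d]. *)
pose v q := fine (w q) + e / (2 ^ q.+1)%:R.
have ve : (\sum_(q <oo) (v q)%:E <= d%:E)%E.
  have := epsilon_trick xpredT w0 (ltW e0).
  under eq_eseriesr do rewrite -[w _]fineK// -EFinD.
  move/le_trans; apply.
  by rewrite [X in (X + _)%E]Fs -(fineK sfin) -EFinD /e lee_fin; lra.
have e2 q : 0 < e / (2 ^ q.+1)%:R by rewrite divr_gt0// ltr0n expn_gt0.
have v0 q : 0 < v q by rewrite /v ltr_wpDl// fine_ge0.
have v1 q : v q < 1.
  apply: lt_le_trans d1; rewrite -lte_fin; apply: lt_le_trans ve.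
  have h : (\sum_(0 <= i < q.+2) (v i)%:E <= \sum_(i <oo) (v i)%:E)%E.
    by apply: nneseries_lim_ge => i _; rewrite lee_fin ltW.
  apply: lt_le_trans h; rewrite 2?big_nat_recr//= -addeA -EFinD.
  apply: lt_le_trans (leeDr _ _); last by apply: sume_ge0 => n _; rewrite lee_fin ltW.
  by rewrite lte_fin ltrDl.
have /choice[k kv] : forall q, exists k : nat, v q < 2^-1 ^+ k <= 2 * v q.
  by move=> q; apply: half_exp_approx; rewrite v0 v1.
have /choice[a aF] : forall q, exists a : rat,
    F q `<=` `]ratr a, ratr a + 2^-1 ^+ k q[%classic.
  move=> q; have /ocitvP[Fq0|[[l r] /= lr Fq]] := mF q.
    by exists 0; rewrite Fq0; exact: sub0set.
  have wq : fine (w q) = r - l.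
    by rewrite /w Fq wlength_itv_bnd// ltW.
  have [a /itvP aI] : exists a : rat, ratr a \in `]r - 2^-1 ^+ k q, l[.
    have [|a aI] := @rat_in_itvoo R (r - 2^-1 ^+ k q) l; last by exists a.
    have /andP[+ _] := kv q; rewrite /v wq; have := e2 q; move: (_ / _) (_ ^+ _) => x y.
    by lra.
  exists a; rewrite Fq => x /=; rewrite !in_itv/= => /andP[lx xr].
  have : ratr a < l by rewrite aI.
  have : r - 2^-1 ^+ k q < ratr a by rewrite aI.
  by move: (_ ^+ _) => y h1 h2; apply/andP; split; lra.
exists a, k; split.
  by move=> x /DF [q _ Fx]; exists q => //; exact: aF.
rewrite EFinM; apply: (@le_trans _ _ (2%:E * \sum_(q <oo) (v q)%:E)%E).
  rewrite -nneseriesZl; last by move=> i _; rewrite lee_fin ltW.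
  apply: lee_nneseries => [i _ _|i _].
    by rewrite lee_fin ltW// half_exp_gt0.
  by rewrite -EFinM lee_fin; have /andP[] := kv i.
by rewrite lee_pmul2l.
Qed.

(** * Measure and null sets along the binary expansion *)

Section binreal_null.
Variable R : realType.
Local Notation binreal := (@binreal R).

Lemma cantor_outer_cyl (K : Type) (c : cyl_code K) :
  (cantor_outer R (cyl c) <= cyl_mass R c)%E.
Proof.
apply: ereal_inf_lbound; exists (fun n => if n is 0%N then c else None).
  by move=> x cx; exists 0%N.
rewrite nneseries_recl//=; last by move=> n _; exact: cyl_mass_ge0.
by rewrite eseries_cond eseries0 ?adde0// => -[|n].
Qed.

(** In an open interval of length $2^{-k}$, the first [k] digits, read as an integer, take at most
    two values, [v] and [v.+1]. So two cylinders of mass $2^{-k}$ cover the preimage. *)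
Lemma cantor_outer_binreal_itv (a : R) (k : nat) :
  (cantor_outer R (binreal @^-1` `]a, (a + 2^-1 ^+ k)%R[) <= (2 * 2^-1 ^+ k)%R%:E)%E.
Proof.
set A := _ @^-1` _.
have [[x0 Ax0]|/forallNP A0] := pselect (exists x, A x); last first.
  rewrite (_ : A = set0); last by rewrite -subset0 => x /A0.
  by rewrite cantor_outer0 lee_fin mulr_ge0// ltW// half_exp_gt0.
have [v [[x Ax xv] vmin]] : exists v, (exists2 x, A x & binval k x = v) /\
    forall y, A y -> (v <= binval k y)%N.
  have ex : exists v, (fun w : nat => `[< exists2 x, A x & binval k x = w >]) v.
    by exists (binval k x0); apply/asboolP; exists x0.
  have [v /asboolP vP vmin] := ex_minnP ex; exists v; split=> // y Ay.
  by apply: vmin; apply/asboolP; exists y.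
have Aval y : A y -> binval k y = v \/ binval k y = v.+1.
  move=> Ay; have vy := vmin _ Ay.
  suff : (binval k y < v.+2)%N.
    by rewrite ltnS leq_eqVlt => /orP[/eqP->|]; [right|rewrite ltnS => h; left;
      apply/eqP; rewrite eqn_leq h].
  move: Ay Ax; rewrite /A /= !in_itv/= => /andP[_ h1] /andP[h2 _].
  have /andP[h3 _] := binreal_bounds R k y.
  have /andP[_ h4] := binreal_bounds R k x.
  move: h3 h4; rewrite /binsum xv => h3 h4.
  rewrite -(ltr_nat R) -2!natr1 -(ltr_pM2r (half_exp_gt0 R k)) !mulrDl !mul1r.
  by move: h1 h2 h3 h4 (half_exp_gt0 R k); move: (_ ^+ k) => u; lra.
have [[y Ay yv]|nex] := pselect (exists2 y, A y & binval k y = v.+1).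
  apply: (@le_trans _ _ (cantor_outer R (cyl (prefix_cyl x k) `|` cyl (prefix_cyl y k)))).
    apply: le_cantor_outer => z Az; rewrite !prefix_cylE.
    have [zv|zv] := Aval _ Az; [left|right]; apply: binval_inj; by rewrite zv.
  apply: le_trans (outer_measureU2 _ _ _) _.
  rewrite mulrDl mul1r EFinD; apply: leeD;
    apply: le_trans (cantor_outer_cyl _) _; by rewrite prefix_cyl_mass.
apply: (@le_trans _ _ (cantor_outer R (cyl (prefix_cyl x k)))).
  apply: le_cantor_outer => z Az; rewrite !prefix_cylE.
  have [zv|zv] := Aval _ Az; first by apply: binval_inj; rewrite zv.
  by exfalso; apply: nex; exists z.
apply: le_trans (cantor_outer_cyl _) _; rewrite prefix_cyl_mass lee_fin.
by rewrite ler_peMl ?ler1n// ltW// half_exp_gt0.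
Qed.

(** One factor 2 comes from rounding the lengths in [interval_cover], the other from the two
    cylinders per interval. *)
Lemma cantor_outer_preimage_binreal (D : set R) (d : R) :
  (lebesgue_measure D < d%:E)%E -> d <= 1 ->
  (cantor_outer R (binreal @^-1` D) <= (4 * d)%R%:E)%E.
Proof.
move=> /interval_cover /[apply] -[a [k [DI kd]]].
apply: (@le_trans _ _ (cantor_outer R (\bigcup_q (binreal @^-1`
    `]ratr (a q), ratr (a q) + 2^-1 ^+ k q[)))).
  by apply: le_cantor_outer => x /DI[q _ h]; exists q.
apply: (le_trans (@cantor_outer_sigma_subadditive R nat _)).
apply: (@le_trans _ _ (\sum_(q <oo) (2%:E * (2^-1 ^+ k q)%:E))%E).
  apply: lee_nneseries => [i _ _|i _]; first exact: cantor_outer_ge0.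
  by rewrite -EFinM; exact: cantor_outer_binreal_itv.
rewrite nneseriesZl; last by move=> i _; rewrite lee_fin ltW// half_exp_gt0.
have -> : ((4 * d)%:E = 2%:E * (2 * d)%:E)%E by rewrite -EFinM; congr EFin; lra.
by rewrite lee_pmul2l.
Qed.

(** When the first [n] coordinates are all prescribed, the image lies in a closed interval of length
    $2^{-n}$. Any other cylinder is split along free coordinates until this is reached. *)
Lemma binreal_cyl_cover (c : cyl_code nat) :
  exists B : set (measurableTypeR R), [/\ measurable B, binreal @` cyl c `<=` B &
    (lebesgue_measure B <= cyl_mass R c)%E].
Proof.
case: c => [[J b]|]; last first.
  by exists set0; split=> //=; rewrite ?image_set0 ?measure0.
have [n Jn] : exists n, forall i : {classic nat}, i \in J -> (i < n)%N.
  exists (\max_(i <- J) (i : nat)).+1 => i iJ.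
  by rewrite ltnS; apply: leq_bigmax_seq.
(* The induction is on a bound [m] for the number of coordinates below [n] left free by [J]. *)
have [m] : exists m, (n - #|` J| <= m)%N by exists (n - #|` J|)%N.
have Jsub : (J `<=` fset_set (`I_n : set {classic nat}))%fset.
  by apply/fsubsetP => i /Jn; rewrite in_fset_ord.
elim: m J b Jn Jsub => [|m IH] J b Jn Jsub; last rewrite leq_eqVlt => /orP[/eqP Jm|]; last first.
- by rewrite ltnS; exact: IH.
- have [k kn kJ] : exists2 k : {classic nat}, (k < n)%N & k \notin J.
    apply: contrapT => h.
    have : (fset_set (`I_n : set {classic nat}) `<=` J)%fset.
      apply/fsubsetP => i; rewrite in_fset_ord => iltn; apply/negPn/negP => iJ.
      by apply: h; exists i.
    by move=> /fsubset_leq_card; rewrite fset_ord_card -subn_eq0 Jm.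
  pose b' w i := if `[< i = k >] then w else b i.
  have kJ' i : i \in (k |` J)%fset -> (i < n)%N.
    by rewrite !inE => /orP[/eqP->//|/Jn].
  have subJ : ((k |` J) `<=` fset_set (`I_n : set {classic nat}))%fset.
    by apply/fsubsetP => i /kJ'; rewrite in_fset_ord.
  have [|B1 [mB1 sB1 lB1]] := IH _ (b' true) kJ' subJ.
    by rewrite cardfsU1 kJ add1n subnS Jm.
  have [|B2 [mB2 sB2 lB2]] := IH _ (b' false) kJ' subJ.
    by rewrite cardfsU1 kJ add1n subnS Jm.
  exists (B1 `|` B2); split; first exact: measurableU.
    move=> _ [x hx <-].
    have hx' : cyl (Some ((k |` J)%fset, b' (x k))) x.
      move=> i; rewrite !inE /b'; case: asboolP => [-> //|ik /orP[/eqP//|]].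
      exact: hx.
    by case: (x k) hx' => hx'; [left; apply: sB1|right; apply: sB2]; exists x.
  apply: le_trans (measureU2 _ mB1 mB2) _.
  apply: le_trans (leeD lB1 lB2) _.
  rewrite /= cardfsU1 kJ/= add1n -EFinD exprS lee_fin.
  by move: (_ ^+ _) => u; lra.
- rewrite leqn0 subn_eq0 => nJ.
  have JE : J = fset_set (`I_n : set {classic nat}).
    by apply/eqP; rewrite eqEfcard Jsub fset_ord_card.
  exists `[binsum R n b, binsum R n b + 2^-1 ^+ n]%classic; split.
  + exact: measurable_itv.
  + move=> _ [x + <-]; rewrite JE -/(prefix_cyl b n) prefix_cylE /= => hx.
    by rewrite in_itv/= -(_ : binsum R n x = binsum R n b) ?binreal_bounds// /binsum (eq_binval hx).
  + rewrite lebesgue_measure_itv/= lte_fin ltrDl half_exp_gt0 -EFinB addrAC subrr add0r.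
    by rewrite JE fset_ord_card.
Qed.

Lemma null_sets_binreal (N : set (nat -> bool)) :
  cantor_outer R N = 0%E -> null_sets R (binreal @` N).
Proof.
move=> N0.
have /choice[B hB] : forall n : nat, exists B : set (measurableTypeR R),
    [/\ measurable B, binreal @` N `<=` B & (lebesgue_measure B <= n.+1%:R^-1%:E)%E].
  move=> n.
  have : (cantor_outer R N < n.+1%:R^-1%:E)%E by rewrite N0 lte_fin invr_gt0.
  move=> /ereal_inf_lt[_ [C NC <-] Cn].
  have /choice[B hB] := fun q => binreal_cyl_cover (C q).
  exists (\bigcup_q B q); split.
  - by apply: bigcup_measurable => q _; have [] := hB q.
  - move=> _ [x /NC [q _ Cx] <-]; exists q => //.
    by have [_ h _] := hB q; apply: h; exists x.
  - apply: le_trans (ltW Cn); apply: le_trans (measure_bigcup_le _ _) _.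
      by move=> q; have [] := hB q.
    apply: lee_nneseries => [q _ _|q _]; first exact: measure_ge0.
    by have [] := hB q.
exists (\bigcap_n B n); split.
- by apply: bigcap_measurable => [|n _]; [exists 0%N|have [] := hB n].
- apply/eqP; rewrite eq_le measure_ge0 andbT; apply/lee_addgt0Pr => e e0.
  have [n ne] : exists n : nat, (n.+1%:R^-1 : R) < e.
    have [n _ /(_ n (leqnn _))] := near_infty_natSinv_lt (PosNum e0).
    by exists n.
  have [mB _ lB] := hB n.
  rewrite add0e; apply: le_trans (_ : (lebesgue_measure (B n) <= _)%E).
    apply: le_measure; rewrite ?inE//.
      by apply: bigcap_measurable => [|m _]; [exists 0%N|have [] := hB m].
    by apply: bigcap_inf.
  by apply: le_trans lB _; rewrite lee_fin ltW.
- by move=> x Nx n _; have [_ h _] := hB n; exact: h.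
Qed.

End binreal_null.

(** * Fair coordinates on [0,1] and {0,1}^K *)

Lemma bigcap_cyl (K : Type) (J : {fset {classic K}}) (b : K -> bool) :
  cyl (Some (J, b)) = \bigcap_(i in [set` J]) [set x : K -> bool | x i = b i].
Proof. by apply/seteqP; split=> x h i; exact: h. Qed.

Section fair_coordinates.
Context d (T : measurableType d) (R : realType) (K : Type).

(** Prescribing the measure of every cylinder makes the coordinates independent and uniform, and
    treats $[0,1]$ and $\{0,1\}^K$ alike. *)
Definition fair_coordinates (mu : set T -> \bar R) (e : T -> K -> bool) :=
  forall c, measurable (e @^-1` cyl c) /\ mu (e @^-1` cyl c) = cyl_mass R c.

End fair_coordinates.

Section unit_interval_digits.
Variable R : realType.
Local Notation unit_itv_val := (@unit_itv_val R).

Lemma measurable_bindigit n :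
  measurable [set r : measurableTypeR R | bindigit r n].
Proof.
have -> : [set r : measurableTypeR R | bindigit r n] = `[1, +oo[%classic `|`
    \bigcup_(m in [set m | odd m]) `[m%:R / 2 ^+ n.+1, m.+1%:R / 2 ^+ n.+1[%classic.
  have p0 : 0 < (2 : R) ^+ n.+1 by rewrite exprn_gt0.
  apply/seteqP; split=> r /=; rewrite /bindigit.
    case: leP => [r1 _|r1 om]; first by left; rewrite /= in_itv/= r1.
    right; exists (Num.truncn (r * 2 ^+ n.+1)) => //=.
    have r0 : 0 <= r * 2 ^+ n.+1.
      have : (0 < Num.truncn (r * 2 ^+ n.+1))%N by case: Num.truncn om.
      by rewrite truncn_gt0; apply: le_trans.
    by rewrite in_itv/= ler_pdivrMr// ltr_pdivlMr// truncn_itv.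
  move=> [|[m om]]; rewrite /= in_itv/= ?andbT; first by move=> ->.
  rewrite ler_pdivrMr// ltr_pdivlMr// => h; case: leP => // _.
  by rewrite (truncn_def h).
apply: measurableU; first exact: measurable_itv.
by apply: bigcup_measurable => m _; exact: measurable_itv.
Qed.

Definition digits (t : unit_itv_space R) : nat -> bool :=
  bindigit (unit_itv_val t).

Lemma digitsK t : binreal R (digits t) = unit_itv_val t.
Proof. by apply: bindigitK; exact: (valP t). Qed.

Lemma measurable_digits_cyl c : measurable (digits @^-1` cyl c).
Proof.
case: c => [[J b]|]; last by rewrite /= preimage_set0.
rewrite bigcap_cyl preimage_bigcap; apply: fin_bigcap_measurable => [|i _].
  exact: finite_fset.
have -> : digits @^-1` [set x | x i = b i] =
    if b i then unit_itv_val @^-1` [set r | bindigit r i]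
    else unit_itv_val @^-1` ~` [set r | bindigit r i].
  case: (b i); first by [].
  by apply/seteqP; split=> t /=; rewrite /digits; [move=> ->|move/negP/negbTE].
case: (b i).
- by exists [set r | bindigit r i]; rewrite ?setTI//; exact: measurable_bindigit.
- exists (~` [set r | bindigit r i]); rewrite ?setTI//.
  by apply: measurableC; exact: measurable_bindigit.
Qed.

Lemma digits_cyl_le c :
  (unit_itv_measure R (digits @^-1` cyl c) <= cyl_mass R c)%E.
Proof.
have [B [mB sB lB]] := binreal_cyl_cover R c.
apply: le_trans lB; apply: le_measure; rewrite ?inE//.
  by apply: measurable_unit_itv_image; exact: measurable_digits_cyl.
by move=> _ [t ht <-]; apply: sB; exists (digits t) => //; exact: digitsK.
Qed.

Lemma unit_itv_measureT : unit_itv_measure R setT = 1%E.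
Proof.
rewrite /unit_itv_measure (_ : _ @` _ = `[0%R, 1%R]%classic).
  by rewrite lebesgue_measure_itv/= lte_fin ltr01 sube0.
apply/seteqP; split=> [_ [t _ <-]|r] /=; rewrite in_itv/=; first exact: (valP t).
by move=> r01; exists (exist _ r r01).
Qed.

(** By induction on [J], the two halves of a cylinder along a coordinate add up to its measure. By
    [digits_cyl_le] neither exceeds one half of it, so both are exactly that. *)
Lemma fair_digits : fair_coordinates (unit_itv_measure R) digits.
Proof.
move=> c; split; first exact: measurable_digits_cyl.
case: c => [[J b]|]; last by rewrite /= preimage_set0 measure0.
elim/finSet_rect: J b => J IH b.
have [->|[k kJ]] := fset_0Vmem J.
  rewrite /= ?cardfs0 expr0 -unit_itv_measureT; congr (unit_itv_measure R _).
  by apply/seteqP; split=> t // _ i; rewrite inE.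
have kJ' : k \notin (J `\ k)%fset by rewrite !inE eqxx.
have IHJ := IH _ (fproperD1 kJ) b.
pose S w := digits @^-1` cyl (Some (k |` (J `\ k), setbit b k w)%fset).
have mS w : measurable (S w) by exact: measurable_digits_cyl.
have SE w : S w = digits @^-1` cyl (Some ((J `\ k)%fset, b)) `&`
    [set t | digits t k = w] by rewrite /S cyl_setbit.
have S_le w : (unit_itv_measure R (S w) <= (2^-1 ^+ #|` J|)%:E)%E.
  apply: le_trans (digits_cyl_le _) _.
  by rewrite /= fsetD1K.
have -> : digits @^-1` cyl (Some (J, b)) = S (b k).
  rewrite /S fsetD1K// (_ : setbit b k (b k) = b)//; apply/funext => i.
  by rewrite /setbit; case: asboolP => [->|].
have SU : (unit_itv_measure R (S (b k)) + unit_itv_measure R (S (~~ b k)) =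
    (2 * 2^-1 ^+ #|` J|)%:E)%E.
  rewrite -measureU//; last first.
    by rewrite !SE -subset0 => t /= [[_ ->] [_]]; case: (b k).
  have -> : S (b k) `|` S (~~ b k) = digits @^-1` cyl (Some ((J `\ k)%fset, b)).
    rewrite !SE -setIUr setIidl// => t _ /=.
    by case: (digits t k); case: (b k); [left|right|right|left].
  by rewrite [LHS]IHJ /= (cardfsD1 k J) kJ add1n -half_expS.
apply/eqP; rewrite eq_le S_le/=.
have : (unit_itv_measure R (S (~~ b k)) < +oo)%E.
  by apply: le_lt_trans (S_le _) _; rewrite ltry.
move: SU (S_le (~~ b k)) (S_le (b k)) (measure_ge0 (unit_itv_measure R) (S (~~ b k))).
case: (unit_itv_measure R (S (b k))) => [u| |] //.
case: (unit_itv_measure R (S (~~ b k))) => [v| |] //.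
rewrite -EFinD !lee_fin => -[uv] h1 _ _ _.
by move: uv h1; set w := _ ^+ _; lra.
Qed.

(** The factor 4 lost along [binreal] turns $1/16$, the bound that [mean_slice_neg] provides, into
    $1/4$. *)
Lemma fair_digits_small D : measurable D ->
  (unit_itv_measure R D < (16^-1)%:E -> cantor_outer R (digits @` D) < 1)%E.
Proof.
move=> mD h; apply: (@le_lt_trans _ _ (4 * 16^-1)%:E); last by rewrite lte_fin; lra.
have := @cantor_outer_preimage_binreal R (unit_itv_val @` D) 16^-1 h.
rewrite invf_le1// ler1n => /(_ isT).
by apply: le_trans; apply: le_cantor_outer => _ [t Dt <-]; exists t; rewrite ?digitsK.
Qed.

End unit_interval_digits.

Section cantor_cylinders.
Variables (R : realType) (K : Type).

(* Only countably many coordinates occur in a cover, so the product measure of a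
   cylinder can be computed in [0,1], along binary digits. *)
Lemma cantor_outer_cylE (c : cyl_code K) : cantor_outer R (cyl c) = cyl_mass R c.
Proof.
apply/eqP; rewrite eq_le cantor_outer_cyl/=.
apply: le_ereal_inf_tmp => _ [C cC <-].
pose supp (c : cyl_code K) : set K := if c is Some (J, _) then [set` J] else set0.
pose I := supp c `|` \bigcup_n supp (C n).
have supp_c c' : countable (supp c').
  case: c' => [[J b]|] /=; last exact: countable0.
  exact: (@countable_fset {classic K} J).
have /countable_injP[g ginj] : countable I.
  have -> : I = \bigcup_n (if n is m.+1 then supp (C m) else supp c).
    apply/seteqP; split=> k; first by move=> [h|[n _ h]]; [exists 0%N|exists n.+1].
    by move=> [[|n] _ h]; [left|right; exists n].
  by apply: bigcup_countable => // -[|n] _.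
have pull c' : supp c' `<=` I -> exists c'', cyl c'' =
    [set x : nat -> bool | cyl c' (fun i => x (g i))] /\ cyl_mass R c'' = cyl_mass R c'.
  move=> c'I; apply: cyl_pullback => J b cJ i j iJ jJ; apply: ginj; rewrite inE.
    by apply: c'I; rewrite cJ.
  by apply: c'I; rewrite cJ.
have [c0 [c0E <-]] := pull c (@subsetUl _ _ _).
have /choice[D hD] : forall n, exists c'', cyl c'' =
    [set x : nat -> bool | cyl (C n) (fun i => x (g i))] /\
    cyl_mass R c'' = cyl_mass R (C n).
  by move=> n; apply: pull => k h; right; exists n.
under eq_eseriesr do rewrite -(hD _).2.
have [mc0 <-] := fair_digits R c0.
under eq_eseriesr do rewrite -(fair_digits R _).2.
apply: le_trans (measure_bigcup_le _ _); last first.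
  by move=> n; exact: (fair_digits R _).1.
apply: le_measure; rewrite ?inE//.
  by apply: bigcup_measurable => n _; exact: (fair_digits R _).1.
move=> t; rewrite /= c0E => /= /cC[n _ h]; exists n => //.
by rewrite /= (hD n).1.
Qed.

Lemma measurable_coordinate (k : K) (v : bool) :
  measurable ([set x | x k = v] : set (Defs.cantor_space R K)).
Proof.
apply: le_caratheodory_measurable => X.
apply: le_ereal_inf_tmp => _ [C XC <-].
have /choice[F hF] : forall n, exists cc : cyl_code K * cyl_code K,
    [/\ cyl cc.1 = cyl (C n) `&` [set x | x k = v],
     cyl cc.2 = cyl (C n) `&` [set x | x k <> v] &
     (cyl_mass R cc.1 + cyl_mass R cc.2 = cyl_mass R (C n))%E].
  by move=> n; have [c' [c'' h]] := cyl_splitb R (C n) k v; exists (c', c'').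
under eq_eseriesr do rewrite -(let: And3 _ _ h := hF _ in h).
rewrite nneseriesD; [|by move=> *; exact: cyl_mass_ge0..].
apply: leeD; apply: ereal_inf_lbound.
  exists (fun n => (F n).1) => // x [/XC[n _ h] xk]; exists n => //.
  by have [-> _ _] := hF n.
exists (fun n => (F n).2) => // x [/XC[n _ h] xk]; exists n => //.
by have [_ -> _] := hF n.
Qed.

Lemma measurable_cyl (c : cyl_code K) :
  measurable (cyl c : set (Defs.cantor_space R K)).
Proof.
case: c => [[J b]|]; last exact: measurable0.
rewrite bigcap_cyl; apply: fin_bigcap_measurable => [|i _].
  exact: finite_fset.
exact: measurable_coordinate.
Qed.

Lemma fair_cantor : fair_coordinates (cantor_measure R K) id.
Proof.
by move=> c; split; [exact: measurable_cyl|exact: cantor_outer_cylE].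
Qed.

End cantor_cylinders.

(** * Independence of disjoint blocks *)

Lemma cardfsU_disjoint (K : choiceType) (A B : {fset K}) :
  [disjoint A & B]%fset -> #|` (A `|` B)%fset| = (#|` A| + #|` B|)%N.
Proof.
move=> AB; have AB0 : (A `&` B)%fset = fset0 by apply/eqP.
by rewrite cardfsU AB0 cardfs0 subn0.
Qed.

Section independent_cylinders.
Context d (T : measurableType d) (R : realType).
Variables (mu : {measure set T -> \bar R}) (K : Type) (e : T -> K -> bool).
Hypothesis fair_e : fair_coordinates mu e.
Implicit Types (F J : {fset {classic K}}) (l : seq {fset {classic K}}).

Definition zero_on F : set T := e @^-1` cyl (Some (F, fun=> false)).

Lemma measurable_zero_on F : measurable (zero_on F).
Proof. exact: (fair_e _).1. Qed.

Lemma measure_zero_on F : mu (zero_on F) = (2^-1 ^+ #|` F|)%:E.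
Proof. exact: (fair_e _).2. Qed.

Lemma fair_measureT : mu setT = 1%E.
Proof.
have := measure_zero_on fset0; rewrite /= ?cardfs0 expr0 => <-; congr (mu _).
by apply/seteqP; split=> t // _ i; rewrite inE.
Qed.

Lemma fair_measure_fin A : measurable A -> mu A \is a fin_num.
Proof.
move=> mA; rewrite ge0_fin_numE//; apply: (@le_lt_trans _ _ (mu setT)).
  by apply: le_measure; rewrite ?inE.
by rewrite fair_measureT ltry.
Qed.

Lemma zero_onI F J : zero_on F `&` zero_on J = zero_on (F `|` J)%fset.
Proof.
apply/seteqP; split=> t /=.
  by move=> [h1 h2] i; rewrite !inE => /orP[]; [exact: h1|exact: h2].
by move=> h; split=> i iF; apply: h; rewrite inE iF ?orbT.
Qed.

Lemma measure_zero_onI F J : [disjoint F & J]%fset ->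
  mu (zero_on F `&` zero_on J) = (2^-1 ^+ #|` F| * 2^-1 ^+ #|` J|)%:E.
Proof.
move=> FJ; rewrite zero_onI measure_zero_on -exprD; congr (_ ^+ _)%:E.
by rewrite cardfsU_disjoint.
Qed.

Fixpoint avoid l : set T :=
  if l is F :: l' then ~` zero_on F `&` avoid l' else setT.

Lemma measurable_avoid l : measurable (avoid l).
Proof.
elim: l => //= F l IH; apply: measurableI => //.
by apply: measurableC; exact: measurable_zero_on.
Qed.

(** The block [J] is carried for the induction: avoiding one more [F] subtracts the same quantity
    with [J] enlarged by [F]. *)
Lemma measure_zero_on_avoid J l : all (fun F => [disjoint J & F]%fset) l ->
  pairwise (fun F F' => [disjoint F & F']%fset) l ->
  mu (zero_on J `&` avoid l) =
  (2^-1 ^+ #|` J| * \prod_(F <- l) (1 - 2^-1 ^+ #|` F|))%:E.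
Proof.
elim: l J => [|F l IH] J /=.
  by rewrite setIT big_nil mulr1 measure_zero_on.
move=> /andP[JF Jl] /andP[Fl pl].
have mJ : measurable (zero_on J `&` avoid l).
  exact: measurableI (measurable_zero_on _) (measurable_avoid _).
have -> : zero_on J `&` (~` zero_on F `&` avoid l) =
    (zero_on J `&` avoid l) `\` zero_on F by rewrite setDE setIA setIAC.
rewrite measureD//; last 2 first.
  exact: measurable_zero_on.
  by rewrite ltey_eq fair_measure_fin.
have JFl : all (fun F' => [disjoint (J `|` F)%fset & F']%fset) l.
  apply/allP => F' F'l; rewrite fdisjointUX (allP Jl _ F'l)/=.
  by move: Fl => /allP /(_ _ F'l).
rewrite setIAC zero_onI [X in (X - _)%E](IH _ Jl pl) [X in (_ - X)%E](IH _ JFl pl).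
rewrite -EFinB big_cons; congr EFin.
have -> : #|` (J `|` F)%fset| = (#|` J| + #|` F|)%N.
  exact: cardfsU_disjoint.
by rewrite exprD; move: (_ ^+ #|` J|) (_ ^+ #|` F|) (\prod_(_ <- _) _) => x y z; ring.
Qed.

(** By independence the measure is $\prod(1-u_F)$, and $(1-u)(1+u+s)\le 1+s$ gives the bound by
    induction. *)
Lemma measure_avoid_le l : pairwise (fun F F' => [disjoint F & F']%fset) l ->
  (mu (avoid l) <= ((1 + \sum_(F <- l) 2^-1 ^+ #|` F|)^-1)%:E)%E.
Proof.
move=> pl; rewrite -[avoid l]setTI.
have -> : setT = zero_on fset0 by apply/seteqP; split=> t // _ i; rewrite inE.
rewrite measure_zero_on_avoid//; last by apply/allP => F _; exact: fdisjoint0X.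
rewrite cardfs0 expr0 mul1r lee_fin.
have S0 l' : 0 <= \sum_(F <- l') (2^-1 : R) ^+ #|` F|.
  by apply: sumr_ge0 => F _; exact/ltW/half_exp_gt0.
rewrite -[X in _ <= X]div1r ler_pdivlMr ?ltr_pwDl//.
elim: l {pl} => [|F l IH]; first by rewrite !big_nil; lra.
rewrite !big_cons; move: (S0 l) IH.
have : 0 <= \prod_(F <- l) (1 - (2^-1 : R) ^+ #|` F|).
  by apply: prodr_ge0 => F' _; rewrite subr_ge0 exprn_ile1//; lra.
have : (2^-1 : R) ^+ #|` F| <= 1 by rewrite exprn_ile1//; lra.
have := half_exp_gt0 R #|` F|.
move: (\sum_(_ <- _) _) (\prod_(_ <- _) _) (_ ^+ _) => s p u u0 u1 p0 s0 h.
apply: le_trans h; have : 0 <= p * (u ^+ 2 + u * s).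
  by rewrite mulr_ge0// addr_ge0 ?exprn_ge0 ?mulr_ge0// ltW.
by nra.
Qed.

Lemma measure_le_avoid A l : measurable A ->
  (mu A <= \sum_(F <- l) mu (A `&` zero_on F) + mu (A `&` avoid l))%E.
Proof.
move=> mA; elim: l => [|F l IH]; first by rewrite big_nil add0e /= setIT.
apply: le_trans IH _; rewrite big_cons /= -addeA addeCA; apply: leeD2l.
have mAl : measurable (A `&` avoid l).
  exact: measurableI mA (measurable_avoid _).
have mF := measurable_zero_on F.
rewrite -[X in (mu X <= _)%E](setIT _) -(setUv (zero_on F)) setIUr.
apply: le_trans (measureU2 _ _ _) _; [exact: measurableI|
  exact: measurableI _ (measurableC _)|].
apply: leeD; apply: le_measure; rewrite ?inE.
- exact: measurableI.
- exact: measurableI.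
- by move=> t [[]].
- exact: measurableI _ (measurableC _).
- apply: measurableI => //; apply: measurableI (measurableC _) (measurable_avoid _).
  exact: mF.
- by move=> t [[]].
Qed.

(** Call an event nearly missed when [A] takes up at most a proportion [eta] of it; [M] caps the
    total measure of the nearly missed events on disjoint blocks. *)
Definition thin_bounds (A : set T) (eta M : R) := 0 < eta /\
  forall l, pairwise (fun F F' => [disjoint F & F']%fset) l ->
  (forall F, F \in l -> (mu (A `&` zero_on F) <= (eta * 2^-1 ^+ #|` F|)%:E)%E) ->
  \sum_(F <- l) 2^-1 ^+ #|` F| <= M.

(* The events [zero_on F] are independent for disjoint [F]: almost every point
   lies in one of them as soon as their measures sum to infinity. *)
Lemma ex_thin_bounds A : measurable A -> (0 < mu A)%E ->
  exists eta M, thin_bounds A eta M.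
Proof.
move=> mA A0; pose a := fine (mu A).
have aE : mu A = a%:E by rewrite fineK// fair_measure_fin.
have a0 : 0 < a by rewrite -lte_fin -aE.
(* Chosen so that $\eta(M+1)=a/3$, while $1/(1+s)<a/3$ as soon as $s>M$: the two parts of [A] then
   have total measure below [a]. *)
pose M := 3 / a; pose eta := a / (3 * (M + 1)).
have M0 : 0 < M by rewrite divr_gt0.
have eta0 : 0 < eta by rewrite divr_gt0// mulr_gt0// ltr_wpDl// ltW.
exists eta, M; split=> //; elim=> [|F l IH]; first by rewrite big_nil ltW.
move=> plF hF; have /= /andP[_ pl] := plF.
have {}IH : \sum_(F <- l) 2^-1 ^+ #|` F| <= M.
  by apply: IH => // F' F'l; apply: hF; rewrite inE F'l orbT.
rewrite leNgt; apply/negP; set s := \sum_(_ <- _) _ => Ms.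
(* The tail of the list already obeys the bound [M], and one event adds at most 1. *)
have sM : s <= M + 1.
  rewrite /s big_cons addrC lerD// exprn_ile1//; lra.
have := measure_le_avoid (F :: l) mA.
apply/negP; rewrite -ltNge aE.
apply: (@le_lt_trans _ _ ((eta * s)%:E + ((1 + s)^-1)%:E)%E).
  apply: leeD; last first.
    apply: le_trans (measure_avoid_le plF); apply: le_measure; rewrite ?inE.
    - exact: measurableI mA (measurable_avoid _).
    - exact: measurable_avoid.
    - by move=> t [].
  rewrite mulr_sumr -sumEFin; rewrite big_seq [X in (_ <= X)%E]big_seq.
  by apply: lee_sum => F' F'l; exact: hF.
rewrite -EFinD lte_fin.
have h1 : eta * s <= a / 3.
  apply: (@le_trans _ _ (eta * (M + 1))); first by rewrite ler_pM2l.
  by rewrite /eta le_eqVlt; apply/orP; left; apply/eqP; field; rewrite gt_eqF//; lra.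
have h2 : (1 + s)^-1 < a / 3.
  rewrite -[X in _ < X]invrK ltf_pV2 ?posrE ?invr_gt0 ?divr_gt0//; last by lra.
  by rewrite invf_div -/M; lra.
by lra.
Qed.

End independent_cylinders.

(** * Disjoint regions cut out by the last level met *)

Section last_event_regions.
Context d (T : measurableType d) (R : realType).
Variables (mu : {measure set T -> \bar R}) (K : Type) (e : T -> K -> bool).
Hypothesis fair_e : fair_coordinates mu e.
Variable F : nat -> nat -> {fset {classic K}}.
Hypothesis F_disj : forall n q n' q', n <> n' -> [disjoint F n q & F n' q']%fset.
Hypothesis F_sum : forall n,
  (\sum_(q <oo) ((2^-1 : R) ^+ #|` F n q|)%:E <= ((2^-1 : R) ^+ n)%:E)%E.
Local Notation U n q := (zero_on e (F n q)).

Definition level n : set T := \bigcup_q U n q.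

(* Going by the last level met makes the regions disjoint, while a region loses
   only a small part of each event of its own levels. *)
Definition last_level m l : set T :=
  \bigcup_(n in [set n | (n %% m)%N = l]) (level n `\` \bigcup_i level (n.+1 + i)).

Lemma measurable_level n : measurable (level n).
Proof. by apply: bigcup_measurable => q _; exact: measurable_zero_on. Qed.

Lemma measurable_last_level m l : measurable (last_level m l).
Proof.
apply: bigcup_measurable => n _; apply: measurableD; first exact: measurable_level.
by apply: bigcup_measurable => i _; exact: measurable_level.
Qed.

Lemma last_level_disj m l l' : l <> l' -> last_level m l `&` last_level m l' = set0.
Proof.
move=> ll'; rewrite -subset0 => t [[n /= nl [Vn nV]] [n' /= n'l [Vn' n'V]]].
have [nn'|nn'|nn'] := ltngtP n n'.
- by apply: nV; exists (n' - n.+1)%N; rewrite ?subnKC.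
- by apply: n'V; exists (n - n'.+1)%N; rewrite ?subnKC.
- by apply: ll'; rewrite -nl -n'l nn'.
Qed.

Lemma measure_level_le n q n' : n <> n' ->
  (mu (U n q `&` level n') <= (2^-1 ^+ n' * 2^-1 ^+ #|` F n q|)%:E)%E.
Proof.
move=> nn'; rewrite setI_bigcupr.
apply: le_trans (measure_bigcup_le _ _) _.
  by move=> q'; apply: measurableI; exact: measurable_zero_on.
under eq_eseriesr do rewrite (measure_zero_onI fair_e (F_disj _ _ nn')) EFinM.
rewrite nneseriesZl; last by move=> i _; rewrite lee_fin ltW// half_exp_gt0.
rewrite mulrC EFinM; apply: lee_wpmul2l => //.
Qed.

(** Up to a null set, a point of [A] in [U n q] must meet a later level. Each later level $n'$ is
    independent of [U n q] and has measure at most $2^{-n'}$; these bounds sum to $2^{-n}$. *)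
Lemma measure_last_level0 m l A n q : measurable A ->
  mu (A `&` last_level m l) = 0%E -> (n %% m)%N = l ->
  (mu (A `&` U n q) <= (2^-1 ^+ n * 2^-1 ^+ #|` F n q|)%:E)%E.
Proof.
move=> mA A0 nl.
pose u : R := 2^-1 ^+ #|` F n q|.
have u0 : 0 <= u by exact/ltW/half_exp_gt0.
have mU := measurable_zero_on fair_e.
have mV := measurable_level.
have mB : measurable (\bigcup_i (U n q `&` level (n.+1 + i))).
  by apply: bigcup_measurable => i _; apply: measurableI.
have mAl : measurable (A `&` last_level m l).
  exact: measurableI mA (measurable_last_level m l).
apply: (@le_trans _ _ (mu (A `&` last_level m l `|`
    \bigcup_i (U n q `&` level (n.+1 + i))))).
  apply: le_measure; rewrite ?inE; [exact: measurableI|exact: measurableU|].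
  move=> t [At Ut].
  have [[i _ Vi]|nV] := pselect ((\bigcup_i level (n.+1 + i)) t).
    by right; exists i.
  by left; split=> //; exists n => //; split=> //; exists q.
apply: le_trans (measureU2 _ mAl mB) _.
rewrite [X in (X + _)%E]A0 add0e.
apply: le_trans (measure_bigcup_le _ _) _; first by move=> i; exact: measurableI.
apply: (@le_trans _ _ (\sum_(i <oo) ((u * 2^-1 ^+ n) / (2 ^ i.+1)%:R)%:E)%E).
  apply: lee_nneseries => [i _ _|i _]; first exact: measure_ge0.
  apply: le_trans (measure_level_le _ _) _.
    by move=> h; have := ltn_addr i (ltnSn n); rewrite -h ltnn.
  rewrite lee_fin -/u addSnnS exprD natrX -exprVn mulrC mulrA.
  by rewrite lexx.
apply: le_trans (epsilon_trick0 _ _) _; first by rewrite mulr_ge0// ltW// half_exp_gt0.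
by rewrite lee_fin mulrC.
Qed.

End last_event_regions.

(** * Almost everywhere calculus in $L_\infty$ *)

Section Linfty_functions.
Context d (T : measurableType d) (R : realType).
Variable mu : {measure set T -> \bar R}.
Hypothesis muT : (0 < mu setT)%E.
Local Notation X := (Linfty mu).
Local Notation Lf := (LfunType mu (@le1_pinfty R)).
Local Open Scope quotient_scope.

(** Allows computing with any convenient representative of a class instead of the one chosen by
    [repr]. *)
Definition represents (u : X) (f : T -> R) := \forall t \ae mu, repr u t = f t.

Lemma represents_repr u : represents u (repr u).
Proof. by apply: filterE. Qed.

Lemma represents_pi (f : Lf) : represents (\pi_X f) f.
Proof. by apply: filterS (repr_ae f) => t; apply. Qed.

Lemma representsD u v f g : represents u f -> represents v g ->
  represents (u + v) (fun t => f t + g t).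
Proof.
rewrite /represents => uf vg.
have uv := represents_pi (repr u + repr v).
by apply: filterS3 uf vg uv => t <- <- huv; exact: huv.
Qed.

Lemma representsZ a u f : represents u f -> represents (a *: u) (fun t => a * f t).
Proof.
rewrite /represents => uf.
have au := represents_pi (a *: repr u).
by apply: filterS2 uf au => t <- hau; exact: hau.
Qed.

Lemma represents_sum (I : Type) (r : seq I) (u : I -> X) (f : I -> T -> R) :
  (forall i, represents (u i) (f i)) ->
  represents (\sum_(i <- r) u i) (fun t => \sum_(i <- r) f i t).
Proof.
move=> uf; elim: r => [|i r IH].
  rewrite big_nil; have := represents_pi 0; apply: filterS => t.
  by rewrite big_nil.
rewrite big_cons; have := representsD (uf i) IH.
by apply: filterS => t ->; rewrite big_cons.
Qed.

Lemma norm_le_ae u f c : represents u f -> 0 <= c ->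
  `|u| <= c <-> \forall t \ae mu, `|f t| <= c.
Proof.
move=> uf c0; rewrite -lee_fin.
have -> : `|u|%:E = ess_sup mu (abse \o (EFin \o repr u)).
  apply: etrans (finite_norm_fine (repr u)) _.
  by rewrite unlock /Lnorm muT.
split.
  move=> /ess_supP; move: uf; rewrite /represents; apply: filterS2 => t <-.
  by rewrite /= lee_fin.
move=> h; apply/ess_supP; move: uf h; apply: filterS2 => t <-.
by rewrite /= lee_fin.
Qed.

Lemma ex_represents (f : T -> R) (c : R) : measurable_fun setT f ->
  (\forall t \ae mu, `|f t| <= c) -> exists u : X, represents u f.
Proof.
move=> mf fc.
have fL : f \in Lfun mu +oo.
  apply/andP; split; first by rewrite inE.
  rewrite inE /= /finite_norm unlock /Lnorm muT.
  apply: (@le_lt_trans _ _ c%:E); last by rewrite ltry.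
  by apply/ess_supP; apply: filterS fc => t; rewrite /= lee_fin.
exists (\pi_X (Lfun_Sub (@le1_pinfty R) fL)).
by have := represents_pi (Lfun_Sub (@le1_pinfty R) fL).
Qed.

End Linfty_functions.

(** * Failing the Daugavet property *)

Lemma unit_ball_sup (R : realType) (X : normedModType R) (f : {linear X -> R^o}) :
  continuous f -> has_sup (f @` @unit_ball R X).
Proof.
move=> fc; split; first by exists (f 0), 0 => //; rewrite /unit_ball /= normr0.
have /linear_boundedP/pinfty_ex_gt0[r r0 rP] := continuous_linear_bounded 0 (fc 0).
exists r => _ [x x1 <-]; apply: le_trans (ler_norm _) _.
by apply: le_trans (rP x) _; rewrite ler_piMr// ltW.
Qed.

Section slices.
Context d (T : measurableType d) (R : realType).
Variable mu : {measure set T -> \bar R}.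
Hypothesis muT : (0 < mu setT)%E.
Local Notation X := (Linfty mu).

(** Only the correction to [f] is recorded, not the corrected function, because the functional is
    applied to sums of corrections. *)
Definition patch (f : T -> R) (P N : set T) (t : T) : R :=
  (1 - f t) * \1_P t - (1 + f t) * \1_N t.

Lemma measurable_patch f P N : measurable_fun setT f -> measurable P ->
  measurable N -> measurable_fun setT (patch f P N).
Proof.
move=> mf mP mN; apply: measurable_funB; apply: measurable_funM.
- exact: measurable_funB.
- exact: measurable_indic.
- exact: measurable_funD.
- exact: measurable_indic.
Qed.

Lemma patch_le f P N t : `|f t| <= 1 -> `|patch f P N t| <= 4.
Proof.
rewrite !ler_norml /patch !indicE => /andP[h1 h2].
by case: (t \in P); case: (t \in N); rewrite /= ?mulr1 ?mulr0; apply/andP; split; lra.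
Qed.

Lemma patch_pos f P N t : P t -> P `&` N = set0 -> f t + patch f P N t = 1.
Proof.
move=> Pt PN; have nN : ~ N t by move=> Nt; have : (P `&` N) t by []; rewrite PN.
by rewrite /patch !indicE (mem_set Pt) (memNset nN) /=; lra.
Qed.

Lemma patch_neg f P N t : N t -> P `&` N = set0 -> f t + patch f P N t = -1.
Proof.
move=> Nt PN; have nP : ~ P t by move=> Pt; have : (P `&` N) t by []; rewrite PN.
by rewrite /patch !indicE (mem_set Nt) (memNset nP) /=; lra.
Qed.

Lemma patch_out f P N t : ~ P t -> ~ N t -> patch f P N t = 0.
Proof. by move=> nP nN; rewrite /patch !indicE (memNset nP) (memNset nN) /=; lra. Qed.

(* If no point of the slice is almost at distance 2 from all of [Y], patch a
   near-maximal point of the slice with the value 1 on one region and -1 on the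
   next. Of many patches with disjoint supports, one costs little and leaves the
   point in the slice; the [y] close to that point then lives off one of the two
   regions. *)
Lemma slice_avoids_region (Y S : set X) (eps : R) :
  Y `<=` @unit_sphere R X -> is_slice S -> 0 < eps ->
  (forall x, S x -> exists y, Y y /\ `|y + x| <= 2 - eps) ->
  exists A : X -> set T, (forall y, Y y -> measurable (A y) /\ (0 < mu (A y))%E) /\
  exists m : nat, forall Q : nat -> set T, (forall l, measurable (Q l)) ->
  (forall l l', l <> l' -> Q l `&` Q l' = set0) ->
  exists y, Y y /\ exists2 l : nat, (l < m)%N & mu (A y `&` Q l) = 0%E.
Proof.
move=> Y1 [f [a [fc a0 SE]]] eps0' hfail'.
(* The cap at 1 keeps the bounds $1-e/2$ and $2-e$ nonnegative, as [norm_le_ae] asks. *)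
pose e := Num.min eps 1.
have e0 : 0 < e by rewrite lt_min eps0' ltr01.
have e1 : e <= 1 by rewrite ge_min lexx orbT.
have hfail x : S x -> exists y, Y y /\ `|y + x| <= 2 - e.
  move=> /hfail'[y [Yy h]]; exists y; split=> //; apply: le_trans h _.
  by rewrite lerB// ge_min lexx.
pose P (y : X) := repr y @^-1` `]1 - e / 2, +oo[%classic.
pose N (y : X) := repr y @^-1` `]-oo, - (1 - e / 2)[%classic.
have mP y : measurable (P y).
  by rewrite -[P y]setTI; apply: (measurable_funP (repr y)) => //; exact: measurable_itv.
have mN y : measurable (N y).
  by rewrite -[N y]setTI; apply: (measurable_funP (repr y)) => //; exact: measurable_itv.
pose A y := if (0 < mu (P y))%E then P y else N y.
exists A; split.
  move=> y Yy; rewrite /A; case: ltP => [//|muP]; split; first exact: mN.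
  rewrite ltNge; apply/negP => muN.
  have : `|y| <= 1 - e / 2.
    apply/(norm_le_ae muT (represents_repr y)); first by lra.
    exists (P y `|` N y); split; first exact: measurableU.
      apply/eqP; rewrite eq_le measure_ge0 andbT.
      apply: le_trans (measureU2 _ (mP y) (mN y)) _.
      by rewrite -(adde0 0%E); exact: leeD.
    move=> t /=; rewrite ler_norml => /negP; rewrite negb_and -!ltNge => /orP[h|h].
      by right; rewrite /N /= in_itv.
    by left; rewrite /P /= in_itv/= andbT.
  by rewrite (Y1 _ Yy); lra.
pose s := sup (f @` @unit_ball R X).
have hs := unit_ball_sup fc.
have f_le x : `|x| <= 1 -> f x <= s.
  by move=> x1; apply: sup_upper_bound => //; exists x.
have f_ge x : `|x| <= 1 -> - s <= f x.
  by move=> x1; rewrite lerNl -linearN; apply: f_le; rewrite normrN.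
have [_ [x x1 <-] fx] : exists2 r, (f @` @unit_ball R X) r & s - a / 2 < r.
  by apply: sup_adherent => //; rewrite divr_gt0.
(* With $ma>4s$, [m] patches that each lose $a/2$ would bring [f] below $-s$ at a point of the unit
   ball. Each patch uses two regions, whence [m.*2]. *)
pose m := (Num.truncn (4 * s / a)).+1.
have ms : 4 * s < m%:R * a by rewrite -ltr_pdivrMr// truncnS_gt.
exists m.*2 => Q mQ Qd; apply: contrapT => hno.
have QdS i : Q i.*2 `&` Q i.*2.+1 = set0.
  by apply: Qd => /n_Sn.
pose h i := patch (repr x) (Q i.*2) (Q i.*2.+1).
have x1ae : \forall t \ae mu, `|repr x t| <= 1.
  by apply/(norm_le_ae muT (represents_repr x)).
have /choice[u hu] : forall i, exists u : X, represents u (h i).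
  move=> i; apply: (@ex_represents _ _ _ _ muT _ 4).
    by apply: measurable_patch => //; exact: measurable_funP.
  by apply: filterS x1ae => t; exact: patch_le.
have patch_norm i t : `|repr x t| <= 1 -> `|repr x t + h i t| <= 1.
  have [Qt|nQ] := pselect (Q i.*2 t); first by rewrite patch_pos// normr1.
  have [Qt|nQ'] := pselect (Q i.*2.+1 t); first by rewrite patch_neg// normrN normr1.
  by rewrite /h patch_out// addr0.
have xu_norm i : `|x + u i| <= 1.
  apply/(norm_le_ae muT (representsD (represents_repr x) (hu i))); first exact: ler01.
  by apply: filterS x1ae => t; exact: patch_norm.
(* A patch losing less than $a/2$ would keep [x + u i] in the slice, since [x] is within $a/2$ of
   the supremum; the [y] failing there would have [A y] null on one of the two regions, against
   [hno]. *)
have fu i : (i < m)%N -> f (u i) <= - (a / 2).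
  move=> im; rewrite leNgt; apply/negP => fui; apply: hno.
  have [y [Yy yxu]] : exists y, Y y /\ `|y + (x + u i)| <= 2 - e.
    apply: hfail; rewrite SE; split; first exact: xu_norm.
    by rewrite linearD /=; move: fx fui; rewrite -/s; lra.
  exists y; split=> //.
  have /(norm_le_ae muT) yae : represents (y + (x + u i))
      (fun t => repr y t + (repr x t + h i t)).
    exact: representsD (represents_repr y) (representsD (represents_repr x) (hu i)).
  have c0 : 0 <= 2 - e by lra.
  have [N0 [mN0 muN0 N0sub]] := (yae _ c0).1 yxu.
  have null B : measurable B -> B `<=` N0 -> mu B = 0%E.
    by move=> mB BN0; apply: (subset_measure0 mB mN0 BN0 muN0).
  have [muP|muP] := boolP (0 < mu (P y))%E.
    exists i.*2; first by rewrite ltn_double.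
    rewrite /A muP; apply: null; first exact: measurableI.
    move=> t [Pt Qt]; apply: N0sub => /=; rewrite (patch_pos _ Qt)//.
    move: Pt; rewrite /P /= in_itv/= andbT => Pt.
    by move=> /(le_trans (ler_norm _)); lra.
  exists i.*2.+1; first by rewrite -doubleS ltn_Sdouble.
  rewrite /A (negbTE muP); apply: null; first exact: measurableI.
  move=> t [Nt Qt]; apply: N0sub => /=; rewrite (patch_neg _ Qt)//.
  move: Nt; rewrite /N /= in_itv/= => Nt; rewrite ler_norml => /andP[+ _].
  by lra.
pose z := x + \sum_(i < m) u i.
have z1 : `|z| <= 1.
  have zrep := representsD (represents_repr x) (represents_sum (index_enum 'I_m) (fun i : 'I_m => hu i)).
  apply/(norm_le_ae muT zrep); first exact: ler01.
  apply: filterS x1ae => t xt.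
  (* The supports are disjoint: at most one patch acts at each point, so the full sum stays in the
     ball. *)
  have [[i it]|hnone] := pselect (exists i : 'I_m, Q i.*2 t \/ Q i.*2.+1 t).
    rewrite (bigD1 i)//= big1 ?addr0 => [|j ji]; first exact: patch_norm.
    have Qne l l' : l <> l' -> Q l t -> ~ Q l' t.
      by move=> ll' Ql Ql'; have : (Q l `&` Q l') t by []; rewrite Qd.
    have ij : (i : nat) <> j by move=> /val_inj ij; rewrite ij eqxx in ji.
    have odd_ij k k' : k.*2 <> k'.*2.+1 by move=> /(congr1 odd); rewrite /= !odd_double.
    apply: patch_out; (case: it => [Qi|Qi]; apply: Qne Qi) => //.
    - by move=> /double_inj.
    - by move=> /esym/odd_ij.
    - by move=> [] /double_inj.
  rewrite big1 ?addr0// => i _; apply: patch_out => Qi; apply: hnone; exists i; auto.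
have := f_ge _ z1; rewrite /z linearD linear_sum /= => fz.
have : \sum_(i < m) f (u i) <= - (m%:R * (a / 2)).
  apply: le_trans (ler_sum _ (fun (i : 'I_m) _ => fu i (ltn_ord i))) _.
  by rewrite sumr_const card_ord mulNrn [in X in _ <= X]mulr_natl.
have := f_le _ x1; rewrite -/s; move: fz ms; move: (m%:R) => M; lra.
Qed.

End slices.

Lemma cof_le (T S : Type) (F : set (set T)) (Y : set S) (g : S -> set T) :
  (forall y, Y y -> F (g y)) ->
  (forall A, F A -> exists2 y, Y y & A `<=` g y) ->
  [set: cof F] #<= Y.
Proof.
move=> gF gcof; rewrite /cof; case: cid => G [Gcof Gmin] /=.
rewrite (card_le_eql (card_setT _)).
apply: card_le_trans (card_image_le g Y); apply: Gmin; split.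
  by move=> _ [y Yy <-]; exact: gF.
by move=> A /gcof[y Yy Ay]; exists (g y) => //; exists y.
Qed.

Lemma half_exp_small (R : realType) (eta : R) : 0 < eta ->
  exists n0 : nat, forall n, (n0 <= n)%N -> (2^-1 : R) ^+ n <= eta.
Proof.
move=> eta0; have [n _ hn] := near_infty_natSinv_expn_lt (PosNum eta0).
exists n => k /hn /=; rewrite div1r -exprVn; exact: ltW.
Qed.

Lemma mod_large (m l b : nat) : (l < m)%N ->
  exists n, (b <= n)%N /\ (n %% m)%N = l.
Proof.
move=> lm; exists (b * m + l)%N; rewrite modnMDl modn_small//; split=> //.
by rewrite (leq_trans _ (leq_addr _ _))// leq_pmulr// (leq_ltn_trans _ lm).
Qed.

Section blocks.
Variables (I : eqType) (K : Type) (phi : I * nat -> K).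
Hypothesis phi_inj : injective phi.

(** Blocks with different labels use different rows of $I\times\mathbb{N}$, so they are disjoint
    whatever their lengths. *)
Definition block (i : I) (k : nat) : {fset {classic K}} :=
  ((fun j : {classic nat} => phi (i, j) : {classic K}) @`
    fset_set (`I_k : set {classic nat}))%fset.

Lemma card_block i k : #|` block i k| = k.
Proof.
rewrite /block card_imfset /= ?fset_ord_card// => j j' /phi_inj.
by case.
Qed.

Lemma block_disjoint i i' k k' : i <> i' -> [disjoint block i k & block i' k']%fset.
Proof.
move=> ii'; apply/fdisjointP => x /imfsetP[j _ ->]; apply/negP => /imfsetP[j' _].
by move=> /phi_inj [].
Qed.

End blocks.

(** * Lower bounds on a family that defeats a slice *)

Section lower_bounds.
Context d (T : measurableType d) (R : realType).
Variables (mu : {measure set T -> \bar R}) (K : Type) (e : T -> K -> bool).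
Hypothesis fair_e : fair_coordinates mu e.
Hypothesis K_infinite : infinite_set [set: K].
Local Notation X := (Linfty mu).
Variables (Y S : set X) (eps : R).
Hypotheses (Y_sphere : Y `<=` @unit_sphere R X) (S_slice : is_slice S)
  (eps_gt0 : 0 < eps)
  (Y_fails : forall x, S x -> exists y, Y y /\ `|y + x| <= 2 - eps).

Lemma ex_thin_sets : exists A : X -> set T,
  (forall y, Y y -> measurable (A y) /\ (0 < mu (A y))%E) /\
  exists m : nat, forall F : nat -> nat -> {fset {classic K}},
  (forall n q n' q', n <> n' -> [disjoint F n q & F n' q']%fset) ->
  (forall n, (\sum_(q <oo) ((2^-1 : R) ^+ #|` F n q|)%:E <= ((2^-1 : R) ^+ n)%:E)%E) ->
  exists y, Y y /\ exists2 l, (l < m)%N & forall n q, (n %% m)%N = l ->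
    (mu (A y `&` zero_on e (F n q)) <= (2^-1 ^+ n * 2^-1 ^+ #|` F n q|)%:E)%E.
Proof.
have muT : (0 < mu setT)%E by rewrite (fair_measureT fair_e).
have [A [hA [m hm]]] := slice_avoids_region muT Y_sphere S_slice eps_gt0 Y_fails.
exists A; split=> //; exists m => F F_disj F_sum.
have [||y [Yy [l lm Al]]] := hm (last_level e F m).
- by move=> l; exact: measurable_last_level fair_e _ _ _.
- by move=> l l'; exact: last_level_disj.
exists y; split=> //; exists l => // n q.
exact: measure_last_level0 fair_e _ F_disj F_sum _ _ _ _ _ (hA _ Yy).1 Al.
Qed.

Lemma thin_bounds_uniq (I : eqType) (phi : I * nat -> K) (k : I -> nat) A eta M l :
  injective phi -> thin_bounds mu e A eta M -> uniq l ->
  (forall i, i \in l ->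
    (mu (A `&` zero_on e (block phi i (k i))) <= (eta * 2^-1 ^+ k i)%:E)%E) ->
  \sum_(i <- l) (2^-1 : R) ^+ k i <= M.
Proof.
move=> phi_inj [_ h] ul hl.
have := h [seq block phi i (k i) | i <- l].
rewrite big_map; under eq_bigr do rewrite card_block//; apply.
  rewrite pairwise_map; apply: sub_pairwise (_ : pairwise (fun i j => i != j) l).
    by move=> i j /eqP ij; exact: block_disjoint.
  by rewrite -uniq_pairwise.
by move=> _ /mapP[i il ->]; rewrite card_block//; exact: hl.
Qed.

(** The levels congruent to [l] are unbounded, and $2^{-n}$ is eventually below [eta y]. The data
    [A], [eta] and [M] precede the choice of blocks, so that the cofinal family built from them does
    not depend on the set to be covered. *)
Lemma ex_thin_sets_bounds : exists (A : X -> set T) (eta M : X -> R),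
  (forall y, Y y -> thin_bounds mu e (A y) (eta y) (M y)) /\
  exists m : nat, forall F : nat -> nat -> {fset {classic K}},
  (forall n q n' q', n <> n' -> [disjoint F n q & F n' q']%fset) ->
  (forall n, (\sum_(q <oo) ((2^-1 : R) ^+ #|` F n q|)%:E <= ((2^-1 : R) ^+ n)%:E)%E) ->
  exists y, Y y /\ forall b, exists2 n, (b <= n)%N & forall q,
    (mu (A y `&` zero_on e (F n q)) <= (eta y * 2^-1 ^+ #|` F n q|)%:E)%E.
Proof.
have [A [hA [m hm]]] := ex_thin_sets.
have /choice[etaM hetaM] : forall y, exists p : R * R, Y y ->
    thin_bounds mu e (A y) p.1 p.2.
  move=> y; have [Yy|nYy] := pselect (Y y); last by exists 0.
  have [mA A0] := hA _ Yy.
  have [eta [M h]] := ex_thin_bounds fair_e mA A0.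
  by exists (eta, M).
exists A, (fun y => (etaM y).1), (fun y => (etaM y).2); split=> //.
exists m => F F_disj F_sum; have [y [Yy [l lm hl]]] := hm F F_disj F_sum.
exists y; split=> // b; have [eta0 _] := hetaM _ Yy.
have [n0 hn0] := half_exp_small eta0.
have [n [nb nl]] := mod_large (maxn b n0) lm.
move: nb; rewrite geq_max => /andP[bn n0n].
exists n => // q; apply: le_trans (hl n q nl) _.
by rewrite lee_fin ler_wpM2r ?hn0// ltW// half_exp_gt0.
Qed.

Lemma cof_null_sets_le : [set: cof (null_sets R)] #<= Y.
Proof.
have [A [eta [M [hA [m hm]]]]] := ex_thin_sets_bounds.
have /infiniteP/card_leTP[iota iota_inj] := K_infinite.
(* A code holds a level, the left endpoint of an interval and the exponent [k] of its length
   $2^{-k}$. Its block has [k] coordinates, so that the event has the length of the interval as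
   measure. *)
pose code := (nat * rat * nat)%type.
pose phi (p : code * nat) : K := iota (choice.pickle p).
have phi_inj : injective phi by move=> p q /iota_inj /(pcan_inj choice.pickleK).
pose J (c : code) : set R := `]ratr c.1.2, ratr c.1.2 + 2^-1 ^+ c.2[%classic.
pose thin y (c : code) := `[< (mu (A y `&` zero_on e (block phi c c.2)) <=
  (eta y * 2^-1 ^+ c.2)%:E)%E >].
pose B y i : set (measurableTypeR R) := if pickle_inv i is Some c then
  if thin y c then J c else set0 else set0.
have mB y i : measurable (B y i).
  rewrite /B; case: pickle_inv => [c|] //; case: ifP => _ //.
  exact: measurable_itv.
apply: (@cof_le _ _ _ _ (fun y => lim_sup_set (B y))).
  move=> y Yy; exists (lim_sup_set (B y)); split => //.
    apply: bigcap_measurable => [|n _]; first by exists 0%N.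
    by apply: bigcup_measurable => i _.
  (* Borel-Cantelli: each partial sum of lengths is bounded by a sum over a duplicate-free list of
     thin codes, which [thin_bounds] caps by [M y]. *)
  apply: lim_sup_set_cvg0 => //.
  apply: (@le_lt_trans _ _ (M y)%:E); last by rewrite ltry.
  apply: lime_le; first by apply: is_cvg_nneseries => *; exact: measure_ge0.
  apply: nearW => n.
  have [l [lthin ul hl]] : exists l : seq code, [/\ forall c, c \in l ->
      thin y c /\ (choice.pickle c < n)%N, uniq l &
      (\sum_(0 <= i < n) lebesgue_measure (B y i) <=
       (\sum_(c <- l) (2^-1 : R) ^+ c.2)%:E)%E].
    elim: n => [|n [l [lthin ul hl]]].
      by exists [::]; split=> //; rewrite big_geq// big_nil.
    rewrite big_nat_recr//=.
    have up c : c \in l -> thin y c /\ (choice.pickle c < n.+1)%N.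
      by move=> /lthin[? h]; split=> //; exact: ltnW.
    have [Bn0|/eqP Bn0] := pselect (B y n = set0).
      by exists l; split=> //; rewrite Bn0 measure0 adde0.
    move: Bn0; rewrite /B; case E: (pickle_inv n) => [c|]; last by rewrite eqxx.
    case: ifP => [tc _|_]; last by rewrite eqxx.
    have cn : choice.pickle c = n by have := @pickle_invK code n; rewrite /= E.
    exists (c :: l); split.
    - by move=> c'; rewrite inE => /orP[/eqP->|/up//]; rewrite cn.
    - rewrite /= ul andbT; apply/negP => /lthin[_]; by rewrite cn ltnn.
    - rewrite big_cons addrC EFinD; apply: leeD => //.
      by rewrite /J lebesgue_measure_itv/= lte_fin ltrDl half_exp_gt0 -EFinB addrAC subrr add0r.
  apply: le_trans hl _; rewrite lee_fin.
  apply: thin_bounds_uniq phi_inj (hA _ Yy) ul _ => c /lthin[+ _].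
  by move=> /asboolP.
move=> N [N' [mN' N'0 NN']].
have /choice[ak hak] : forall n : nat, exists p : (nat -> rat) * (nat -> nat),
    N' `<=` \bigcup_q `]ratr (p.1 q), ratr (p.1 q) + 2^-1 ^+ p.2 q[%classic /\
    (\sum_(q <oo) ((2^-1 : R) ^+ p.2 q)%:E <= ((2^-1 : R) ^+ n)%:E)%E.
  (* The exponent [n.+1] absorbs the factor 2 of [interval_cover]. *)
  move=> n; have [||a [k [h1 h2]]] := @interval_cover R N' (2^-1 ^+ n.+1).
  - by rewrite N'0 lte_fin half_exp_gt0.
  - by rewrite exprn_ile1// invf_le1// ler1n.
  - by exists (a, k); rewrite half_expS.
pose F n q := block phi (n, (ak n).1 q, (ak n).2 q) ((ak n).2 q).
have [||y [Yy hy]] := hm F.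
- by move=> n q n' q' nn'; apply: block_disjoint => // -[].
- move=> n; under eq_eseriesr do rewrite card_block//.
  exact: (hak n).2.
exists y => // x /NN' N'x j _.
pose lev (i : nat) : nat := if @pickle_inv code i is Some c then c.1.1 else 0%N.
(* A level from [b] on occurs in no code of index below [j], so the code found there has index at
   least [j]. *)
pose b := (\max_(i < j) lev i).+1.
have [n bn hn] := hy b.
have [q _ xq] := (hak n).1 _ N'x.
pose c : code := (n, (ak n).1 q, (ak n).2 q).
exists (choice.pickle c).
  rewrite /= leqNgt; apply/negP => cj.
  move: bn; apply/negP; rewrite -ltnNge ltnS.
  have := @leq_bigmax _ (fun i : 'I_j => lev i) (Ordinal cj).
  by rewrite /lev /= pickleK_inv.
rewrite /B pickleK_inv ifT//; apply/asboolP.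
by have := hn q; rewrite /F card_block.
Qed.

Lemma cof_countable_subsets_le : [set: cof (countable_subsets K)] #<= Y.
Proof.
have [A [eta [M [hA [m hm]]]]] := ex_thin_sets_bounds.
have /infiniteP/card_leTP[iota iota_inj] := K_infinite.
have /card_leTP[pr pr_inj] := infinite_card_square K_infinite.
pose code := ({classic K} * (nat * nat))%type.
pose phi (p : code * nat) : K := pr (p.1.1, iota (choice.pickle (p.1.2, p.2))).
have phi_inj : injective phi.
  move=> [[j nq] i] [[j' nq'] i'] /pr_inj [-> /iota_inj /(pcan_inj choice.pickleK)].
  by case=> -> ->.
(* At level [n], the sizes $n+q+1$ make the measures sum to $2^{-n}$ over [q]. *)
pose sz (c : code) := (c.2.1 + c.2.2).+1.
pose thin y (c : code) := (mu (A y `&` zero_on e (block phi c (sz c))) <=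
  (eta y * 2^-1 ^+ sz c)%:E)%E.
apply: (@cof_le _ _ _ _ (fun y => [set j : K | exists nq, thin y (j, nq)])).
  move=> y Yy; rewrite /countable_subsets /=.
  have -> : [set j : K | exists nq, thin y (j, nq)] =
      \bigcup_(nq in [set: nat * nat]) [set j : K | thin y (j, nq)].
    by apply/seteqP; split=> j [nq]; [exists nq|exists nq].
  apply: bigcup_countable => // nq _; apply: finite_set_countable.
  apply: contrapT => inf.
  (* For fixed [nq] all blocks have size [k], so more than $2^k$ times [M y] thin indices would
     exceed the cap. *)
  pose k := (nq.1 + nq.2).+1.
  have [B Bthin Bn] := @infinite_set_fset {classic K} _
    (Num.truncn (M y / 2^-1 ^+ k)).+1 inf.
  have uB : uniq [seq (j, nq) : code | j <- B].
    by rewrite map_inj_uniq ?fset_uniq// => j j' [].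
  have : \sum_(c <- [seq (j, nq) : code | j <- B]) (2^-1 : R) ^+ sz c <= M y.
    by apply: (thin_bounds_uniq phi_inj (hA _ Yy) uB) => c /mapP[j /Bthin ? ->].
  rewrite big_map; under eq_bigr do rewrite /sz /= -/k.
  rewrite big_const_seq count_predT iter_addr_0.
  apply/negP; rewrite -ltNge -[X in _ < X]mulr_natl -ltr_pdivrMr ?half_exp_gt0//.
  by apply: lt_le_trans (truncnS_gt _) _; rewrite ler_nat.
move=> J /countable_injP[f f_inj].
(* [j_] inverts the enumeration of [J], with a default off its range; repeated values are harmless,
   since disjointness is asked between different levels. *)
have /choice[j_ hj_] : forall q, exists j : K, forall j', J j' -> f j' = q -> j = j'.
  move=> q; have [[j [Jj <-]]|hn] := pselect (exists j, J j /\ f j = q).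
    by exists j => j' Jj' /esym; apply: f_inj; rewrite inE.
  by exists (iota 0%N) => j' Jj' fj'; exfalso; apply: hn; exists j'.
pose c_ n q : code := (j_ q, (n, q)).
pose F n q := block phi (c_ n q) (sz (c_ n q)).
have [||y [Yy hy]] := hm F.
- by move=> n q n' q' nn'; apply: block_disjoint => // -[].
- move=> n; under eq_eseriesr do rewrite card_block//.
  apply: le_trans (@epsilon_trick0 R _ xpredT (ltW (half_exp_gt0 R n))).
  apply: lee_nneseries => [q _ _|q _]; first by rewrite lee_fin ltW// half_exp_gt0.
  by rewrite lee_fin /sz /= -addnS exprD natrX -exprVn.
exists y => // j Jj /=; have [n _ hn] := hy 0%N.
exists (n, f j); have := hn (f j).
by rewrite /F /c_ /thin (hj_ (f j) j Jj erefl) card_block.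
Qed.

End lower_bounds.

(** * A base of positive sets in {0,1}^nat *)

Section flips.
Variable R : realType.
Implicit Types (F : {fset nat}) (c : cyl_code nat) (x : nat -> bool).

Definition flip F x (i : nat) : bool := x i (+) (i \in F).

Definition flip_code F c : cyl_code nat :=
  if c is Some (J, b) then Some (J, flip F b) else None.

Lemma flipK F : involutive (flip F).
Proof. by move=> x; apply/funext => i; rewrite /flip addbK. Qed.

Lemma cyl_flip F c : cyl (flip_code F c) = flip F @^-1` cyl c.
Proof.
case: c => [[J b]|] //=; apply/seteqP; split=> x /= h i /h; rewrite /flip.
  by move=> ->; rewrite addbK.
by move=> <-; rewrite addbK.
Qed.

Lemma cyl_mass_flip F c : cyl_mass R (flip_code F c) = cyl_mass R c.
Proof. by case: c => [[J b]|]. Qed.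

Lemma cantor_outer_flip F A : cantor_outer R (flip F @^-1` A) = cantor_outer R A.
Proof.
have le B : (cantor_outer R (flip F @^-1` B) <= cantor_outer R B)%E.
  apply: le_ereal_inf_tmp => _ [C BC <-]; apply: ereal_inf_lbound.
  exists (fun q => flip_code F (C q)).
    by move=> x /BC[q _ h]; exists q => //; rewrite cyl_flip.
  by under eq_eseriesr do rewrite cyl_mass_flip.
apply/eqP; rewrite eq_le le/=.
have {1}-> : A = flip F @^-1` (flip F @^-1` A).
  by apply/seteqP; split=> x; rewrite /= flipK.
exact: le.
Qed.

(** The largest subset of [O] invariant under finite flips; it plays the part of a tail event in a
    zero-one law. *)
Definition flip_core (O : set (nat -> bool)) : set (nat -> bool) :=
  [set x | forall F, O (flip F x)].

Lemma flip_core_sub O : flip_core O `<=` O.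
Proof.
move=> x /(_ fset0); congr O; apply/funext => i.
by rewrite /flip inE addbF.
Qed.

Lemma flip_core_flip F O : flip F @^-1` flip_core O = flip_core O.
Proof.
have h x : flip_core O x -> flip_core O (flip F x).
  move=> Ox G; have := Ox ((F `\` G) `|` (G `\` F))%fset; congr O.
  apply/funext => i; rewrite /flip !inE -addbA; congr (_ (+) _).
  by case: (i \in F); case: (i \in G).
apply/seteqP; split=> x; last exact: h.
by move=> /h; rewrite flipK.
Qed.

Lemma cantor_outerIC (A X : set (nat -> bool)) :
  measurable (A : set (Defs.cantor_space R nat)) ->
  cantor_outer R X = (cantor_outer R (X `&` A) + cantor_outer R (X `&` ~` A))%E.
Proof. by move=> /(_ X). Qed.

Lemma cantor_outer_le1 (A : set (nat -> bool)) : (cantor_outer R A <= 1)%E.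
Proof.
apply: (@le_trans _ _ (cantor_outer R (cyl (Some (fset0, fun _ : nat => false))))).
  by apply: le_cantor_outer => x _ i; rewrite inE.
by rewrite cantor_outer_cylE /= ?cardfs0 expr0.
Qed.

(* Invariance under flips makes [flip_core O] independent of every cylinder. *)
Lemma cantor_outer_flip_core O c :
  cantor_outer R (flip_core O `&` cyl c) =
  (cyl_mass R c * cantor_outer R (flip_core O))%E.
Proof.
case: c => [[J b]|]; last by rewrite /= setI0 cantor_outer0 mul0e.
elim/finSet_rect: J b => J IH b.
have [->|[k kJ]] := fset_0Vmem J.
  rewrite /= ?cardfs0 expr0 mul1e; congr (cantor_outer R _); apply: setIidl => x _ i.
  by rewrite inE.
have kJ' : k \notin (J `\ k)%fset by rewrite !inE eqxx.
have cJ : cyl (Some (J, b)) =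
    cyl (Some ((J `\ k)%fset, b)) `&` [set x | x k = b k].
  rewrite -cyl_setbit// fsetD1K// (_ : setbit b k (b k) = b)//; apply/funext => i.
  by rewrite /setbit; case: asboolP => [->|].
have := cantor_outerIC (flip_core O `&` cyl (Some ((J `\ k)%fset, b)))
  (measurable_coordinate R (k : nat) (b k)).
rewrite (IH _ (fproperD1 kJ)) -setIA -cJ.
(* Flipping [k] exchanges the two halves of the larger cylinder, so each carries half of the outer
   measure. *)
have -> : (flip_core O `&` cyl (Some ((J `\ k)%fset, b))) `&`
     ~` [set x | x k = b k] = flip [fset (k : nat)]%fset @^-1` (flip_core O `&` cyl (Some (J, b))).
  rewrite preimage_setI flip_core_flip -setIA; congr (_ `&` _).
  rewrite cJ preimage_setI; congr (_ `&` _).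
    have flip_k x (i : {classic nat}) : i \in (J `\ k)%fset ->
        flip [fset (k : nat)]%fset x i = x i.
      rewrite !inE => /andP[ik _]; rewrite /flip inE.
      have -> : ((i : nat) == (k : nat)) = false.
        by apply/eqP => h; move: ik; rewrite h eqxx.
      by rewrite addbF.
    apply/seteqP; split=> x h i iJ; have := h i iJ; rewrite /= flip_k//.
  apply/seteqP; split=> x /=; rewrite /flip inE eqxx addbT; by case: (x k); case: (b k).
rewrite cantor_outer_flip /= (cardfsD1 k J) kJ add1n.
have : (cantor_outer R (flip_core O `&` cyl (Some (J, b))) \is a fin_num).
  rewrite ge0_fin_numE; last exact: cantor_outer_ge0.
  by rewrite (le_lt_trans (cantor_outer_le1 _))// ltry.
have : (cantor_outer R (flip_core O) \is a fin_num).
  rewrite ge0_fin_numE; last exact: cantor_outer_ge0.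
  by rewrite (le_lt_trans (cantor_outer_le1 _))// ltry.
case: (cantor_outer R (flip_core O)) => [u| |] // _.
case: (cantor_outer R _) => [v| |] // _.
rewrite -!EFinM -EFinD => -[h]; congr EFin.
by move: h; rewrite half_expS; move: (_ ^+ _.+1) => w h; lra.
Qed.

(** The traces of the core [N] on the covering cylinders give $|N|\le s|N|$ for outer measures, with
    $s<1$ the total mass of the cover. *)
Lemma flip_core_null (W : nat -> cyl_code nat) :
  (\sum_(q <oo) cyl_mass R (W q) < 1)%E ->
  cantor_outer R (flip_core (\bigcup_q cyl (W q))) = 0%E.
Proof.
move=> W1; set N := flip_core _.
have : (cantor_outer R N <= (\sum_(q <oo) cyl_mass R (W q)) * cantor_outer R N)%E.
  apply: (@le_trans _ _ (cantor_outer R (\bigcup_q (N `&` cyl (W q))))).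
    by apply: le_cantor_outer => x Nx; have [q _ h] := flip_core_sub Nx; exists q.
  apply: (le_trans (@cantor_outer_sigma_subadditive R nat _)).
  under eq_eseriesr do rewrite cantor_outer_flip_core muleC.
  have : (cantor_outer R N \is a fin_num).
    rewrite ge0_fin_numE; last exact: cantor_outer_ge0.
    by rewrite (le_lt_trans (cantor_outer_le1 _))// ltry.
  rewrite -/N; case: (cantor_outer R N) => [u| |] // _.
  by rewrite nneseriesZl 1?muleC// => i _; exact: cyl_mass_ge0.
have : (0 <= \sum_(q <oo) cyl_mass R (W q))%E.
  by apply: nneseries_ge0 => *; exact: cyl_mass_ge0.
have := cantor_outer_ge0 R N; have := cantor_outer_le1 N.
move: W1; case: (\sum_(q <oo) _)%E => [s| |] //; case: (cantor_outer R N) => [u| |] //.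
rewrite -EFinM !lee_fin lte_fin => s1 u1 u0 s0 h; congr EFin.
by nra.
Qed.

End flips.

Section baire.
Variable R : realType.
Variables (V W : nat -> cyl_code nat).
Local Notation O := (\bigcup_q cyl (W q)).
Hypothesis V1 : (\sum_(q <oo) cyl_mass R (V q) < 1)%E.
Hypothesis WV : flip_core O `<=` \bigcup_q cyl (V q).

Definition seq_cyl (s : seq bool) := prefix_cyl (nth false s) (size s).

Definition seq_cyl_diff (C : nat -> cyl_code nat) (s : seq bool) : set (nat -> bool) :=
  cyl (seq_cyl s) `\` \bigcup_q cyl (C q).

Local Notation A := (seq_cyl_diff V).

Lemma seq_cylE s : cyl (seq_cyl s) =
  [set x | forall i, (i < size s)%N -> x i = nth false s i].
Proof. exact: prefix_cylE. Qed.

Lemma cyl_support_bound (c : cyl_code nat) : exists n, forall x y,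
  (forall i, (i < n)%N -> x i = y i) -> cyl c x -> cyl c y.
Proof.
case: c => [[J b]|]; last by exists 0%N.
exists (\max_(i <- J) (i : nat)).+1 => x y xy h i iJ.
rewrite -h// xy// ltnS; exact: leq_bigmax_seq.
Qed.

(** There are countably many finite sequences. The traces [A s'] of those extending [s] inside the
    flipped open set cover the given set of positive outer measure, so one of them is not null. *)
Lemma baire_step F s : (0 < cantor_outer R (A s `&` flip F @^-1` O))%E ->
  exists s', [/\ (size s < size s')%N,
    forall i, (i < size s)%N -> nth false s' i = nth false s i,
    cyl (seq_cyl s') `<=` flip F @^-1` O & (0 < cantor_outer R (A s'))%E].
Proof.
move=> pos; apply: contrapT => hno.
pose good s' := [/\ (size s < size s')%N,
    forall i, (i < size s)%N -> nth false s' i = nth false s i &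
    cyl (seq_cyl s') `<=` flip F @^-1` O].
pose Z q := if choice.unpickle q is Some s' then
  (if `[< good s' >] then A s' else set0) else set0.
have Z0 q : cantor_outer R (Z q) = 0%E.
  rewrite /Z; case: choice.unpickle => [s'|]; last exact: cantor_outer0.
  case: asboolP => [[h1 h2 h3]|_]; last exact: cantor_outer0.
  apply/eqP; rewrite eq_le cantor_outer_ge0 andbT leNgt; apply/negP => h.
  by apply: hno; exists s'.
move: pos; apply/negP; rewrite -leNgt.
apply: (@le_trans _ _ (cantor_outer R (\bigcup_q Z q))); last first.
  apply: (le_trans (@cantor_outer_sigma_subadditive R nat _)).
  by rewrite eseries0// => i _ _; exact: Z0.
apply: le_cantor_outer => z [[zs zV] [q _ zq]].
have [n hn] := cyl_support_bound (flip_code F (W q)).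
(* Long enough to decide the flipped cylinder of [W q], and strictly longer than [s]. *)
pose s' := mkseq z (maxn n (size s).+1).
have zs' i : (i < size s')%N -> nth false s' i = z i.
  by rewrite size_mkseq => h; rewrite nth_mkseq.
have ss' : (size s < size s')%N by rewrite size_mkseq leq_maxr.
have gs' : good s'.
  split=> // [i is_|y].
    rewrite zs'; last exact: ltn_trans is_ ss'.
    by move: zs; rewrite seq_cylE; apply.
  rewrite seq_cylE => ys'; exists q => //.
  suff : (flip F @^-1` cyl (W q)) y by [].
  rewrite -cyl_flip; apply: (hn z); last by rewrite cyl_flip.
  by move=> i iltn; rewrite ys' ?zs'// size_mkseq (leq_trans iltn)// leq_maxl.
exists (choice.pickle s') => //; rewrite /Z choice.pickleK asboolT//.
by split=> //; rewrite seq_cylE => i /zs'.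
Qed.

(* Otherwise, flip after flip, nested cylinders shrink to a point of
   [flip_core O] that lies outside all the [V q]. *)
Lemma baire : exists F s, (0 < cantor_outer R (A s))%E /\
  cantor_outer R (A s `&` flip F @^-1` O) = 0%E.
Proof.
apply: contrapT => hno.
have pos F s : (0 < cantor_outer R (A s))%E ->
    (0 < cantor_outer R (A s `&` flip F @^-1` O))%E.
  move=> As; rewrite lt_neqAle cantor_outer_ge0 andbT eq_sym.
  by apply/eqP => h; apply: hno; exists F, s.
have A0 : (0 < cantor_outer R (A [::]))%E.
  rewrite lt_neqAle cantor_outer_ge0 andbT; apply/eqP => /esym A0.
  have : (cantor_outer R [set: nat -> bool] <= \sum_(q <oo) cyl_mass R (V q))%E.
    apply: (@le_trans _ _ (cantor_outer R (A [::] `|` \bigcup_q cyl (V q)))).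
      apply: le_cantor_outer => x _.
      have [?|?] := pselect ((\bigcup_q cyl (V q)) x); [by right|left].
      by split=> //; rewrite seq_cylE.
    apply: (le_trans (outer_measureU2 _ _ _)); rewrite [X in (X + _)%E]A0 add0e.
    apply: ereal_inf_lbound; by exists V.
  apply/negP; rewrite -ltNge; apply: lt_le_trans V1 _.
  have -> : [set: nat -> bool] = cyl (Some (fset0, fun _ : nat => false)).
    by apply/seteqP; split=> x // _ i; rewrite inE.
  by rewrite cantor_outer_cylE /= ?cardfs0 expr0.
pose step_spec F (s s' : {s | (0 < cantor_outer R (A s))%E}) :=
  [/\ (size (sval s) < size (sval s'))%N,
    forall i, (i < size (sval s))%N -> nth false (sval s') i = nth false (sval s) i &
    cyl (seq_cyl (sval s')) `<=` flip F @^-1` O].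
have /choice[step hstep] : forall Fs : {fset nat} * {s | (0 < cantor_outer R (A s))%E},
    exists s', step_spec Fs.1 Fs.2 s'.
  move=> [F [s As]]; have [s' [h1 h2 h3 As']] := baire_step (pos F s As).
  by exists (exist _ s' As').
pose flipset i : {fset nat} := odflt fset0 (choice.unpickle i).
(* Stage [n] enters the preimage of [O] under the [n]-th finite flip, so the limit [z] has every
   finite modification in [O]. *)
pose st := fix st n := if n is m.+1 then step (flipset m, st m) else exist _ [::] A0.
have stS n : step_spec (flipset n) (st n) (st n.+1) by exact: (hstep (_, _)).
have st_size n : (n <= size (sval (st n)))%N.
  elim: n => // n IH; have [h _ _] := stS n; exact: leq_ltn_trans h.
have st_agree n k i : (i < size (sval (st n)))%N ->
    nth false (sval (st (n + k)%N)) i = nth false (sval (st n)) i.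
  move=> hi; elim: k => [|k IH]; first by rewrite addn0.
  rewrite addnS; have [_ -> //] := stS (n + k)%N.
  apply: leq_trans hi _; elim: (k) => [|k' IHk]; first by rewrite addn0.
  by rewrite addnS; have [h _ _] := stS (n + k')%N; exact: leq_trans IHk (ltnW h).
pose z i := nth false (sval (st i.+1)) i.
have zst n : cyl (seq_cyl (sval (st n))) z.
  rewrite seq_cylE => i hi; rewrite /z.
  have [h|h] := leqP n i.+1.
    by rewrite -(subnKC h) st_agree.
  by rewrite -(subnKC (ltnW h)) st_agree//; exact: st_size.
have zN : flip_core O z.
  move=> F; have [_ _ h] := stS (choice.pickle F).
  have := h _ (zst _); by rewrite /flipset choice.pickleK.
have [q _ zq] := WV zN.
(* Once the sequence [st n] decides all coordinates of [V q], its cylinder lies inside [cyl (V q)],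
   leaving [A] empty. *)
have [n hn] := cyl_support_bound (V q).
have := svalP (st n); rewrite (_ : A _ = set0) ?cantor_outer0 ?ltxx//.
rewrite -subset0 => y [ys]; apply; exists q => //; apply: (hn z) zq => i iltn.
have := zst n; move: ys; rewrite seq_cylE => /(_ i) -> => [|]; last first.
  exact: leq_trans iltn (st_size n).
by move=> /(_ i) ->//; exact: leq_trans iltn (st_size n).
Qed.

End baire.

(** For each null [G] the base is countable and independent of [W]; letting [G] run through a
    cofinal family of null sets therefore gives few sets. They are flips of cylinders minus a cover
    of mass below 1 of the preimage of [G]. *)
Lemma cantor_base (R : realType) :
  exists base : set R -> nat -> set (nat -> bool),
  (forall G i, exists c C, base G i = cyl c `\` \bigcup_(q : nat) cyl (C q)) /\
  forall W : nat -> cyl_code nat, (\sum_(q <oo) cyl_mass R (W q) < 1)%E ->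
  exists N : set R, null_sets R N /\ forall G, null_sets R G -> N `<=` G ->
  exists i, (0 < cantor_outer R (base G i))%E /\
    cantor_outer R (base G i `&` \bigcup_q cyl (W q)) = 0%E.
Proof.
have /choice[V hV] : forall G : set R, exists V : nat -> cyl_code nat,
    null_sets R G -> (\sum_(q <oo) cyl_mass R (V q) < 1)%E /\
      binreal R @^-1` G `<=` \bigcup_q cyl (V q).
  move=> G; have [[B [mB B0 GB]]|nG] := pselect (null_sets R G); last first.
    by exists (fun=> None).
  have /ereal_inf_lt[_ [V BV <-] V1] : (cantor_outer R (binreal R @^-1` B) < 1)%E.
    apply: le_lt_trans (cantor_outer_preimage_binreal (d := 8^-1) _ _) _.
    - by rewrite B0 lte_fin invr_gt0.
    - by rewrite invf_le1// ler1n.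
    - by rewrite lte_fin; lra.
  by exists V => _; split=> // x Gx; apply: BV; exact: GB.
pose index i : {fset nat} * seq bool := odflt (fset0, [::]) (choice.unpickle i).
exists (fun G i => flip (index i).1 @^-1` seq_cyl_diff (V G) (index i).2); split.
  move=> G i; exists (flip_code (index i).1 (seq_cyl (index i).2)).
  exists (fun q => flip_code (index i).1 (V G q)).
  rewrite cyl_flip; under eq_bigcupr do rewrite cyl_flip.
  by rewrite -preimage_bigcup.
move=> W W1; exists (binreal R @` flip_core (\bigcup_q cyl (W q))); split.
  by apply: null_sets_binreal; exact: flip_core_null.
move=> G G0 NG; have [V1 GV] := hV G G0.
have WV : flip_core (\bigcup_q cyl (W q)) `<=` \bigcup_q cyl (V G q).
  by move=> x Wx; apply: GV; apply: NG; exists x.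
have [F [s [pos null]]] := baire V1 WV.
exists (choice.pickle (F, s)); rewrite /index choice.pickleK /=; split.
  by rewrite cantor_outer_flip.
rewrite -(cantor_outer_flip R F) preimage_setI -comp_preimage.
rewrite (_ : flip F \o flip F = id); last by apply/funext => x /=; rewrite flipK.
by rewrite preimage_id.
Qed.

(** * The witness of failure *)

Section mean_functional.
Context d (T : measurableType d) (R : realType).
Variable mu : {measure set T -> \bar R}.
Hypothesis muT1 : mu setT = 1%E.
Local Notation X := (Linfty mu).

Let muT : (0 < mu setT)%E. Proof. by rewrite muT1. Qed.

Definition Linfty_mean (u : X) : R^o := \int[mu]_t repr u t.

Lemma represents_integral_le (u : X) f : represents u f -> measurable_fun setT f ->
  (\int[mu]_t `|(f t)%:E| <= `|u|%:E)%E.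
Proof.
move=> uf mf; rewrite -[X in (_ <= X)%E]mule1 -muT1.
apply: integral_le_bound => //; first exact/measurable_EFinP.
have /(norm_le_ae muT uf) : `|u| <= `|u| by [].
move=> /(_ (normr_ge0 _)); apply: filterS => t ft _.
by rewrite /= lee_fin.
Qed.

Lemma represents_integrable (u : X) f : represents u f -> measurable_fun setT f ->
  mu.-integrable setT (EFin \o f).
Proof.
move=> uf mf; apply/integrableP; split; first exact/measurable_EFinP.
by apply: le_lt_trans (represents_integral_le uf mf) _; rewrite ltry.
Qed.

Lemma represents_mean u f : represents u f -> measurable_fun setT f ->
  Linfty_mean u = \int[mu]_t f t.
Proof.
move=> uf mf; congr fine; apply: ae_eq_integral => //.
- by apply/measurable_EFinP; exact: measurable_funP.
- exact/measurable_EFinP.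
- by move: uf; rewrite /represents; apply: filterS => t ->.
Qed.

Lemma integrable_repr (u : X) : mu.-integrable setT (EFin \o repr u).
Proof.
apply: (represents_integrable (represents_repr u)); exact: measurable_funP.
Qed.

Lemma Linfty_mean_linear : linear Linfty_mean.
Proof.
move=> a u v.
have mu_ : measurable_fun setT (repr u) by exact: measurable_funP.
have mv : measurable_fun setT (repr v) by exact: measurable_funP.
have mau : measurable_fun setT (fun t => a * repr u t) by exact: measurable_funM.
rewrite (represents_mean (representsD (representsZ a (represents_repr u))
  (represents_repr v))); last exact: measurable_funD.
rewrite RintegralD//; last exact: integrable_repr.
  by rewrite RintegralZl//; exact: integrable_repr.
exact: represents_integrable (representsZ a (represents_repr u)) mau.
Qed.

HB.instance Definition _ := GRing.isLinear.Build R X R^o *:%R Linfty_mean Linfty_mean_linear.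

Lemma Linfty_mean_le (u : X) : `|Linfty_mean u| <= `|u|.
Proof.
rewrite -lee_fin EFin_normr_Rintegral//; last exact: integrable_repr.
apply: le_trans (le_abse_integral _ _ _) _ => //.
  by apply/measurable_EFinP; exact: measurable_funP.
by apply: represents_integral_le (represents_repr u) _; exact: measurable_funP.
Qed.

Lemma Linfty_mean_continuous : continuous Linfty_mean.
Proof.
apply: (@bounded_linear_continuous R X R^o Linfty_mean).
apply/bounded_funP => r; exists r => x xr; exact: le_trans (Linfty_mean_le x) xr.
Qed.

Definition mean_slice : set X := [set x | @unit_ball R X x /\
  Linfty_mean x > sup (Linfty_mean @` @unit_ball R X) - 16^-1].

Lemma mean_slice_is_slice : is_slice mean_slice.
Proof.
exists Linfty_mean, 16^-1; split => //; exact: Linfty_mean_continuous.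
Qed.

(** Where $x<0$ one has $1-x>1$, so the measure of that set is at most the mean of $1-x$. This is
    below $1/16$, as the constant 1 shows that the supremum is at least 1. *)
Lemma mean_slice_neg (x : X) : mean_slice x ->
  (mu (repr x @^-1` `]-oo, 0%R[) < (16^-1)%:E)%E.
Proof.
move=> [x1 xs].
have m1 : measurable_fun setT (fun _ : T => 1 : R) by exact: measurable_cst.
have [u hu] : exists u : X, represents u (fun=> 1).
  by apply: (@ex_represents _ _ _ _ muT _ 1) => //; apply: filterE => t; rewrite normr1.
have int1 := represents_integrable hu m1.
have sup1 : 1 <= sup (Linfty_mean @` @unit_ball R X).
  apply: ub_le_sup; first exact: (unit_ball_sup Linfty_mean_continuous).2.
  exists u.
    apply/(norm_le_ae muT hu); first exact: ler01.
    by apply: filterE => t; rewrite normr1.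
  by rewrite (represents_mean hu)// Rintegral_cst// muT1 mul1r.
set D := _ @^-1` _.
have mx : measurable_fun setT (repr x) by exact: measurable_funP.
have mD : measurable D by rewrite -[D]setTI; apply: mx => //; exact: measurable_itv.
(* This representative of [x] is at most 1 everywhere, which makes the comparison of $1_D$ with
   $1-f$ pointwise. *)
pose f t := Num.min (repr x t) 1.
have mf : measurable_fun setT f by apply: measurable_minr.
have xf : represents x f.
  have /(norm_le_ae muT (represents_repr x)) : `|x| <= 1 by [].
  move=> /(_ ler01); apply: filterS => t; rewrite ler_norml => /andP[_ h].
  by rewrite /f min_l.
have m1f : measurable_fun setT (fun t => 1 - f t) by exact: measurable_funB.
have intf := represents_integrable xf mf.
have intD : mu.-integrable setT (EFin \o \1_D).
  apply: (le_integrable measurableT _ _ int1).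
    by apply/measurable_EFinP; exact: measurable_indic.
  by move=> t _ /=; rewrite indicE lee_fin; case: (_ \in _); rewrite ?normr1 ?normr0.
have : \int[mu]_t \1_D t <= \int[mu]_t (1 - f t).
  apply: le_Rintegral => //.
    by have := integrableB measurableT int1 intf.
  move=> t _; rewrite indicE /f; case: (boolP (t \in D)) => [|_] /=.
    rewrite inE /D /= in_itv/= => h; rewrite min_l ?(le_trans (ltW h))//.
    by rewrite lerBrDr gerDl ltW.
  by rewrite subr_ge0 ge_min lexx orbT.
rewrite RintegralB// Rintegral_cst// muT1 mul1r -(represents_mean xf mf).
have -> : \int[mu]_t \1_D t = fine (mu D) by rewrite /Rintegral integral_indic// setIT.
have Dfin : mu D \is a fin_num.
  rewrite ge0_fin_numE//; apply: (@le_lt_trans _ _ (mu setT)).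
    by apply: le_measure; rewrite ?inE.
  by rewrite muT1 ltry.
move=> h; rewrite -(fineK Dfin) lte_fin; apply: le_lt_trans h _.
by rewrite ltrBlDr addrC -ltrBlDr; apply: le_lt_trans xs; rewrite lerB.
Qed.

End mean_functional.

Lemma cof_family (T : Type) (F : set (set T)) : exists v : cof F -> set T,
  (forall i, F (v i)) /\ forall A, F A -> exists i, A `<=` v i.
Proof.
rewrite /cof; case: cid => G [[GF Gcof] _] /=.
exists (fun i => val i); split=> [i|A /Gcof[B GB AB]]; first exact/GF/set_valP.
by exists (SigSub (mem_set GB)).
Qed.

Lemma card_le_cof (T : Type) (F H : set (set T)) :
  cofinal_subfamily F H -> [set: cof F] #<= H.
Proof.
move=> Hc; rewrite /cof; case: cid => G [Gcof Gmin] /=.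
by rewrite (card_le_eql (card_setT _)); exact: Gmin.
Qed.

(** The union of a countable cofinal family would be null, yet it would contain every singleton and
    hence $[0,1]$. *)
Lemma infinite_cof_null_sets (R : realType) : infinite_set [set: cof (null_sets R)].
Proof.
move=> /finite_set_countable /countable_injP[f f_inj].
have [v [vnull vcof]] := cof_family (null_sets R).
pose G n : set R := [set r | exists2 i, f i = n & v i r].
have Gnull n : null_sets R (G n).
  have [[i fi]|hn] := pselect (exists i, f i = n).
    apply: (negligibleS _ (vnull i)) => r [j fj]; rewrite (f_inj j i) ?inE//.
    by rewrite fi fj.
  apply: (negligibleS _ (negligible_set0 _)) => r [i fi _].
  by apply: hn; exists i.
have := negligible_bigcup Gnull.
move=> [B [mB B0 GB]].
have : (lebesgue_measure (`[0%R, 1%R]%classic : set R) <= lebesgue_measure B)%E.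
  apply: le_measure; rewrite ?inE//.
  move=> r _; apply: GB.
  have [i hi] : exists i, [set r] `<=` v i.
    apply: vcof; exists [set r]; split=> //; exact: countable_lebesgue_measure0 (countable1 _).
  by exists (f i) => //; exists i => //; exact: hi.
by rewrite B0 lebesgue_measure_itv/= lte_fin ltr01 sube0 lee_fin ler10.
Qed.

Lemma infinite_countable_enum (K : Type) (H : set K) : countable H ->
  infinite_set H -> exists h : nat -> K, injective h /\
    forall k, H k -> exists n, h n = k.
Proof.
move=> cH iH; have : [set: nat] #= H by rewrite card_eq_sym; exact: eq_card_nat.
move=> /card_bijP[f [g fK gK]].
exists (fun n => val (f (SigSub (mem_set (I : [set: nat] n))))); split.
  by move=> m n /val_inj /(can_inj fK) /(congr1 val).
move=> k Hk; exists (val (g (SigSub (mem_set Hk)))).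
rewrite (_ : SigSub _ = g (SigSub (mem_set Hk))) ?gK//.
exact: val_inj.
Qed.

(** * Upper bound and the value of the Daugavet cardinal *)

Section upper_bound.
Context d (T : measurableType d) (R : realType).
Variables (mu : {measure set T -> \bar R}) (K : Type) (e : T -> K -> bool).
Hypothesis fair_e : fair_coordinates mu e.

Lemma fair_restrict (h : nat -> K) : injective h ->
  fair_coordinates mu (fun t n => e t (h n)).
Proof.
move=> h_inj c.
have [c' [c'E <-]] := @cyl_pullback R _ _ h c (fun _ _ _ => in2W h_inj).
have := fair_e c'; by rewrite c'E.
Qed.

Lemma fair_outer_le (psi : T -> nat -> bool) (Z : set (nat -> bool)) :
  fair_coordinates mu psi -> measurable (psi @^-1` Z) ->
  (mu (psi @^-1` Z) <= cantor_outer R Z)%E.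
Proof.
move=> fpsi mZ; apply: le_ereal_inf_tmp => _ [C ZC <-].
under eq_eseriesr do rewrite -(fpsi _).2.
apply: le_trans (measure_bigcup_le _ _); last by move=> n; exact: (fpsi _).1.
apply: le_measure; rewrite ?inE//.
  by apply: bigcup_measurable => n _; exact: (fpsi _).1.
by move=> t /ZC[n _ h]; exists n.
Qed.

(** Covers bound measures from above only; applied to the complement, where both totals are 1, this
    yields the lower bound that keeps [D p] of positive measure. *)
Lemma fair_diff (psi : T -> nat -> bool) (c : cyl_code nat) (C : nat -> cyl_code nat) :
  fair_coordinates mu psi ->
  let B := cyl c `\` \bigcup_(q : nat) cyl (C q) in
  measurable (psi @^-1` B) /\ (cantor_outer R B <= mu (psi @^-1` B))%E.
Proof.
move=> fpsi B.
have mB : measurable (psi @^-1` B).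
  have -> : psi @^-1` B = psi @^-1` cyl c `\` \bigcup_q (psi @^-1` cyl (C q)).
    by rewrite -preimage_bigcup.
  apply: measurableD; first exact: (fpsi _).1.
  by apply: bigcup_measurable => q _; exact: (fpsi _).1.
split=> //.
have cB : measurable (B : set (Defs.cantor_space R nat)).
  apply: measurableD; first exact: measurable_cyl.
  by apply: bigcup_measurable => q _; exact: measurable_cyl.
have outerT : cantor_outer R [set: nat -> bool] = 1%E.
  have -> : [set: nat -> bool] = cyl (Some (fset0, fun _ : nat => false)).
    by apply/seteqP; split=> x // _ i; rewrite inE.
  by rewrite cantor_outer_cylE /= ?cardfs0 expr0.
have := cantor_outerIC setT cB; rewrite !setTI outerT => outer1.
have mu1 : (mu (psi @^-1` B) + mu (psi @^-1` ~` B) = 1)%E.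
  rewrite -(fair_measureT fpsi) -measureU//.
  - by rewrite -preimage_setU setUv preimage_setT.
  - by rewrite -preimage_setC; exact: measurableC.
  - by rewrite -preimage_setC setICr.
have leC : (mu (psi @^-1` ~` B) <= cantor_outer R (~` B))%E.
  by apply: fair_outer_le => //; rewrite -preimage_setC; exact: measurableC.
move: outer1 mu1 leC (cantor_outer_ge0 R B) (cantor_outer_ge0 R (~` B))
  (measure_ge0 mu (psi @^-1` B)) (measure_ge0 mu (psi @^-1` ~` B)).
case: (cantor_outer R B) => [a| |] //; case: (cantor_outer R (~` B)) => [b| |] //.
case: (mu (psi @^-1` B)) => [a'| |] //; case: (mu _) => [b'| |] //.
rewrite -!EFinD !lee_fin => -[h1] [h2] h3 _ _ _ _.
by move: h1 h2 h3; lra.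
Qed.

Hypothesis fair_small : forall D, measurable D ->
  (mu D < (16^-1)%:E -> cantor_outer R (e @` D) < 1)%E.
Hypothesis K_infinite : infinite_set [set: K].
Local Notation X := (Linfty mu).
Local Notation index := (cof (null_sets R) * cof (countable_subsets K) * nat)%type.

Lemma ex_blocking_sets : exists D : index -> set T, forall Z,
  measurable Z -> (mu Z < (16^-1)%:E)%E -> exists p,
  [/\ measurable (D p), (0 < mu (D p))%E & mu.-negligible (D p `&` Z)].
Proof.
have [vN [vNnull vNcof]] := cof_family (null_sets R).
have [vK [vKcount vKcof]] := cof_family (countable_subsets K).
have /infiniteP/card_leTP[iota iota_inj] := K_infinite.
have [base [baseE baseP]] := cantor_base R.
(* Finite [vK i] receive [iota] as a default; only infinite ones are selected below. *)
have /choice[h hP] : forall i, exists h : nat -> K, infinite_set (vK i) ->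
    injective h /\ forall k, vK i k -> exists n, h n = k.
  move=> i; have [fi|ifi] := pselect (finite_set (vK i)); first by exists iota.
  have [h hP] := infinite_countable_enum (vKcount i) ifi.
  by exists h.
pose psi i (t : T) (n : nat) := e t (h i n).
exists (fun p => psi p.1.2 @^-1` base (vN p.1.1) p.2) => Z mZ Z_small.
have /ereal_inf_lt[_ [W ZW <-] W1] := fair_small mZ Z_small.
pose supp (c : cyl_code K) : set K := if c is Some (J, _) then [set` J] else set0.
have supp_c c : countable (supp c).
  case: c => [[J b]|] /=; last exact: countable0.
  exact: (@countable_fset {classic K} J).
(* Including the range of [iota] forces [vK i] to be infinite, so that [h i] really enumerates
   it. *)
have [i hi] : exists i, range iota `|` \bigcup_q supp (W q) `<=` vK i.
  apply: vKcof; rewrite /countable_subsets /=.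
  have -> : range iota `|` \bigcup_q supp (W q) =
      \bigcup_q (if q is q'.+1 then supp (W q') else range iota).
    apply/seteqP; split=> k.
      by move=> [?|[q _ ?]]; [exists 0%N|exists q.+1].
    by move=> [[|q] _ ?]; [left|right; exists q].
  apply: bigcup_countable => // -[|q] _ //.
  by apply: card_le_trans (card_image_le _ _) _; exact: countableP.
have inf_i : infinite_set (vK i).
  apply/infiniteP; apply: card_le_trans (subset_card_le (_ : range iota `<=` _)).
    have E : range iota #= [set: nat] by apply: inj_card_eq => m n _ _; exact: iota_inj.
    by rewrite -(card_le_eql E) card_lexx.
  by move=> k ?; apply: hi; left.
have [h_inj h_surj] := hP i inf_i.
have fpsi := fair_restrict h_inj.
(* [g] inverts [h i] on [vK i], which contains all coordinates of the cover [W]; along it [W]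
   becomes a cover in $\{0,1\}^{\mathbb{N}}$ of the same mass. *)
have /choice[g gP] : forall k, exists n, vK i k -> h i n = k.
  move=> k; have [hk|nhk] := pselect (vK i k); last by exists 0%N.
  by have [n hn] := h_surj k hk; exists n.
have /choice[W' hW'] : forall q, exists c' : cyl_code nat,
    cyl c' = [set z : nat -> bool | cyl (W q) (fun k => z (g k))] /\
    cyl_mass R c' = cyl_mass R (W q).
  move=> q; apply: cyl_pullback => J b WJ k k' kJ k'J gk.
  have suppW k0 : k0 \in J -> vK i k0.
    by move=> k0J; apply: hi; right; exists q => //; rewrite WJ.
  by rewrite -(gP k (suppW _ kJ)) -(gP k' (suppW _ k'J)) gk.
have W'1 : (\sum_(q <oo) cyl_mass R (W' q) < 1)%E.
  by under eq_eseriesr do rewrite (hW' _).2.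
have ZW' t : Z t -> (\bigcup_q cyl (W' q)) (psi i t).
  move=> Zt; have [|q _ Wq] := ZW (e t); first by exists t.
  exists q => //; rewrite (hW' q).1 /=.
  have suppW k : supp (W q) k -> vK i k by move=> sk; apply: hi; right; exists q.
  move: Wq suppW; case: (W q) => [[J b]|] //= Wq suppW k kJ.
  by rewrite /psi gP ?Wq//; exact: suppW.
have [N [N0 NP]] := baseP W' W'1.
have [j Nj] := vNcof N N0.
have [n [pos null]] := NP _ (vNnull j) Nj.
exists (j, i, n); have [c [C bE]] := baseE (vN j) n.
have [mD leD] := fair_diff c C fpsi.
move: pos null; rewrite /= bE => pos null.
split; [exact: mD|exact: lt_le_trans pos leD|].
pose B := cyl c `\` \bigcup_(q : nat) cyl (C q).
have mW' : measurable (psi i @^-1` (\bigcup_q cyl (W' q))).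
  by rewrite preimage_bigcup; apply: bigcup_measurable => q _; exact: (fpsi _).1.
have mI : measurable (psi i @^-1` (B `&` \bigcup_q cyl (W' q))).
  by rewrite preimage_setI; exact: measurableI.
exists (psi i @^-1` (B `&` \bigcup_q cyl (W' q))); split=> //.
  apply/eqP; rewrite eq_le measure_ge0 andbT -[X in (_ <= X)%E]null.
  exact: fair_outer_le.
by move=> t [Bt Zt]; split=> //; exact: ZW'.
Qed.

(** Any [x] of the slice satisfies $0\le x\le 1$ almost everywhere on some [D p], so adding $-1_{D}$
    keeps the norm at most 1. Positive measure of [D p] gives $-1_{D}$ norm 1. *)
Lemma ex_blocking_functions : exists Y : set X,
  [/\ Y `<=` @unit_sphere R X, Y #<= [set: index] &
   forall x, mean_slice x -> exists2 y, Y y & `|y + x| <= 1].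
Proof.
have muT1 := fair_measureT fair_e.
have muT : (0 < mu setT)%E by rewrite muT1.
have [D hD] := ex_blocking_sets.
pose good p := measurable (D p) /\ (0 < mu (D p))%E.
have /choice[y yP] : forall p, exists y : X, good p ->
    represents y (fun t => - \1_(D p) t).
  move=> p; have [[mD _]|nD] := pselect (good p); last by exists 0.
  have [||y hy] := @ex_represents _ _ _ mu muT (fun t => - \1_(D p) t : R) 1.
  - by apply: measurable_funN; exact: measurable_indic.
  - apply: filterE => t; rewrite normrN indicE.
    by case: (t \in D p); rewrite /= ?normr1 ?normr0.
  - by exists y.
exists (y @` good); split.
- move=> _ [p [mD D0] <-]; have yp := yP p (conj mD D0).
  have y1 : `|y p| <= 1.
    apply/(norm_le_ae muT yp); first exact: ler01.
    apply: filterE => t; rewrite normrN indicE.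
    by case: (t \in D p); rewrite /= ?normr1 ?normr0.
  apply/eqP; rewrite eq_le y1/= leNgt; apply/negP => ylt.
  have : `|y p| <= `|y p| by [].
  move=> /(norm_le_ae muT yp (normr_ge0 _)) [N [mN N0 hN]].
  move: D0; rewrite (subset_measure0 mD mN _ N0) ?ltxx// => t Dt.
  apply: hN => /=; rewrite normrN indicE mem_set// normr1.
  by apply/negP; rewrite -ltNge.
- exact: card_le_trans (card_image_le _ _) (card_leT _).
move=> x xS; have [x1 _] := xS.
have mZ : measurable (repr x @^-1` `]-oo, 0%R[).
  rewrite -[_ @^-1` _]setTI; exact: (measurable_funP (repr x)).
have [p [mD D0 DZ]] := hD _ mZ (mean_slice_neg muT1 xS).
exists (y p); first by exists p.
apply/(norm_le_ae muT (representsD (yP p (conj mD D0)) (represents_repr x))).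
  exact: ler01.
have /(norm_le_ae muT (represents_repr x) ler01) x1ae : `|x| <= 1 by [].
have DZae : \forall t \ae mu, ~ (D p `&` repr x @^-1` `]-oo, 0%R[) t.
  by move: DZ; rewrite /almost_everywhere; congr (mu.-negligible _);
    apply/seteqP; split=> t /= => [h []|/contrapT].
apply: filterS2 x1ae DZae => t /=.
rewrite !ler_norml in_itv/= indicE => /andP[h1 h2] nDZ.
have [Dt|nD] := pselect (D p t); last by rewrite memNset//= oppr0 add0r h1.
rewrite mem_set//=; have : 0 <= repr x t.
  by rewrite leNgt; apply/negP => h; apply: nDZ.
by move=> h; apply/andP; split; lra.
Qed.

Lemma fair_is_Dau : is_Dau X
  (card_max (cof (null_sets R)) (cof (countable_subsets K))).
Proof.
set M := card_max _ _.
have NM : [set: cof (null_sets R)] #<= [set: M].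
  by rewrite /M /card_max; case: ifP.
have KM : [set: cof (countable_subsets K)] #<= [set: M].
  rewrite /M /card_max; case: ifP => // /negbT h.
  by have [h'|//] := card_le_total (cof (null_sets R)) (cof (countable_subsets K)); rewrite h' in h.
have M_inf : infinite_set [set: M].
  apply/infiniteP; apply: card_le_trans NM; apply/infiniteP.
  exact: infinite_cof_null_sets.
(* Three factors bounded by the infinite [M] are absorbed by using its pairing twice. *)
have iM : [set: index] #<= [set: M].
  have /card_leTP[f f_inj] := NM; have /card_leTP[g g_inj] := KM.
  have /infiniteP/card_leTP[k k_inj] := M_inf.
  have /card_leTP[pr pr_inj] := infinite_card_square M_inf.
  apply/card_leTP; exists (fun p => pr (pr (f p.1.1, g p.1.2), k p.2)).
  by move=> [[a b] c] [[a' b'] c'] /= /pr_inj [/pr_inj [/f_inj -> /g_inj ->] /k_inj ->].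
split.
  have [Y [Y1 YM Yx]] := ex_blocking_functions.
  move=> /(_ Y Y1 (card_le_trans YM iM) _ (mean_slice_is_slice (fair_measureT fair_e)) 1 ltr01).
  move=> [x xS xY]; have [y Yy yx] := Yx x xS.
  by have := xY y Yy; rewrite ltNge => /negP; apply; apply: le_trans yx _; lra.
move=> L nL.
have [Y [Y1 [YL [S [Sslice [eps [eps0 Sfail]]]]]]] : exists Y : set X,
    Y `<=` @unit_sphere R X /\ Y #<= [set: L] /\ exists S, is_slice S /\
    exists eps : R, 0 < eps /\
    forall x, S x -> exists y, Y y /\ `|y + x| <= 2 - eps.
  apply: contrapT => hno; apply: nL => Y Y1 YL S Sslice eps eps0.
  apply: contrapT => hno'; apply: hno.
  exists Y; split=> //; split=> //; exists S; split=> //; exists eps; split=> // x Sx.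
  apply: contrapT => hy; apply: hno'; exists x => // y Yy.
  by rewrite ltNge; apply/negP => h; apply: hy; exists y.
rewrite /M /card_max; case: ifP => _; apply: card_le_trans YL.
  by have := cof_countable_subsets_le fair_e K_infinite Y1 Sslice eps0 Sfail.
by have := cof_null_sets_le fair_e K_infinite Y1 Sslice eps0 Sfail.
Qed.

End upper_bound.

Theorem proposition5p4 (R : realType) :
  (forall kappa : cardinal, infinite_set [set: kappa] ->
     is_Dau (Linfty (cantor_measure R kappa))
            (card_max (cof (null_sets R)) (cof (countable_subsets kappa)))) /\
  is_Dau (Linfty (unit_itv_measure R)) (cof (null_sets R)).
Proof.
split=> [kappa kappa_inf|].
  have small D : measurable D -> (cantor_measure R kappa D < (16^-1)%:E ->
      cantor_outer R (id @` D) < 1)%E.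
    by move=> _ h; rewrite image_id; apply: lt_trans h _; rewrite lte_fin; lra.
  by have := fair_is_Dau (@fair_cantor R kappa) small kappa_inf.
have := fair_is_Dau (@fair_digits R) (@fair_digits_small R) infinite_nat.
(* For [nat] the single set [setT] is cofinal, so the second cofinality is finite while that of the
   null sets is infinite. *)
rewrite /card_max ifF//; apply/negbTE/negP => le.
apply: (@infinite_cof_null_sets R); apply: card_le_finite le _.
have : cofinal_subfamily (countable_subsets nat) [set setT].
  by split=> [_ ->|A _]; [exact: countableP|exists setT].
move=> /card_le_cof h; exact: card_le_finite h (finite_set1 _).
Qed.
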